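(* (i) For every Banach Lie algebra $\mathcal{L}$, $$P_{\mathfrak{S}}(\mathcal{L})\subseteq P_{\mathfrak{J}}(\mathcal{L})\subseteq P_{\mathfrak{S}^{\max}}(\mathcal{L})\subseteq P_{\mathfrak{J}^{\max}}(\mathcal{L}).$$ If $\mathcal{L}$ has a proper closed Lie subalgebra of finite codimension, then $P_{\mathfrak{J}^{\max}}(\mathcal{L})\neq\mathcal{L}$. (ii) $P_{\mathfrak{S}}^{\circ}=P_{\mathfrak{J}}^{\circ}=P_{\mathfrak{S}^{\max}}^{\circ}=P_{\mathfrak{J}^{\max}}^{\circ}$; that is, these four maps take the same value on every Banach Lie algebra, and they are radicals. (iii) For every Banach Lie algebra $\mathcal{L}$, $$r^{\circ}_{P_{\mathfrak{S}}}(\mathcal{L})\leq r^{\circ}_{P_{\mathfrak{J}}}(\mathcal{L})\leq r^{\circ}_{P_{\mathfrak{S}^{\max}}}(\mathcal{L})\leq r^{\circ}_{P_{\mathfrak{J}^{\max}}}(\mathcal{L}).$$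
   Context: A Banach Lie algebra is a complex Lie algebra $\mathcal{L}$ which is a Banach space in a norm such that, for some $t_{\mathcal{L}}>0$, $\|[a,b]\|\leq t_{\mathcal{L}}\|a\|\|b\|$ for all $a,b\in\mathcal{L}$. For a Banach Lie algebra $\mathcal{L}$ let: $\mathfrak{S}_{\mathcal{L}}$ be the family of all proper closed Lie subalgebras of finite codimension in $\mathcal{L}$; $\mathfrak{S}^{\max}_{\mathcal{L}}$ the family of all maximal proper closed Lie subalgebras of finite codimension; $\mathfrak{J}_{\mathcal{L}}$ the family of all proper closed Lie ideals of finite codimension; $\mathfrak{J}^{\max}_{\mathcal{L}}$ the family of all maximal proper closed Lie ideals of finite codimension. For $\Gamma\in\{\mathfrak{S},\mathfrak{S}^{\max},\mathfrak{J},\mathfrak{J}^{\max}\}$ put $P_{\Gamma}(\mathcal{L})=\bigcap_{L\in\Gamma_{\mathcal{L}}}L$, with $P_{\Gamma}(\mathcal{L})=\mathcal{L}$ if $\Gamma_{\mathcal{L}}=\varnothing$. Each $P_\Gamma(\mathcal{L})$ is a closed Lie ideal of $\mathcal{L}$. For a map $R$ sending each Banach Lie algebra $\mathcal{L}$ to a closed Lie ideal $R(\mathcal{L})$ of $\mathcal{L}$, define by transfinite recursion $R^{0}(\mathcal{L})=\mathcal{L}$, $R^{\alpha+1}(\mathcal{L})=R(R^{\alpha}(\mathcal{L}))$, and $R^{\alpha}(\mathcal{L})=\bigcap_{\alpha'<\alpha}R^{\alpha'}(\mathcal{L})$ for limit ordinals $\alpha$. This decreasing chain stabilizes; $r_{R}^{\circ}(\mathcal{L})$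 denotes the smallest ordinal $\beta$ with $R^{\beta+1}(\mathcal{L})=R^{\beta}(\mathcal{L})$, and $R^{\circ}(\mathcal{L})=R^{r_{R}^{\circ}(\mathcal{L})}(\mathcal{L})$. A preradical (in the category of Banach Lie algebras whose morphisms are bounded Lie homomorphisms with dense image) is a map $R$ sending each Banach Lie algebra $\mathcal{L}$ to a closed Lie ideal $R(\mathcal{L})$ such that $f(R(\mathcal{L}))\subseteq R(\mathcal{M})$ for every morphism $f:\mathcal{L}\to\mathcal{M}$. It is a radical if, for all Banach Lie algebras $\mathcal{L}$: $R(R(\mathcal{L}))=R(\mathcal{L})$ (lower stable), $R(\mathcal{L}/R(\mathcal{L}))=\{0\}$ (upper stable), and $R(I)\subseteq R(\mathcal{L})$ for every closed Lie ideal $I$ of $\mathcal{L}$ (balanced). *)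

(* Defs.v *)
From HB Require Import structures.
From mathcomp Require Import all_boot all_order all_algebra ring_quotient.
From mathcomp Require Import complex ring.
From mathcomp Require Import all_classical all_reals.
From mathcomp Require Import interval_inference topology normedtype sequences.

Set Implicit Arguments.
Unset Strict Implicit.
Unset Printing Implicit Defensive.

Import Order.TTheory GRing.Theory Num.Theory.
Import numFieldNormedType.Exports.

Local Open Scope classical_set_scope.
Local Open Scope complex_scope.
Local Open Scope ring_scope.
Local Open Scope quotient_scope.

HB.mixin Record isBanachLie (R : realType) L
    & CompleteNormedModule R[i] L := {
  lie : L -> L -> L;
  lie_linearl : forall b, linear (lie ^~ b);
  lie_linearr : forall a, linear (lie a);
  liexx : forall a, lie a a = 0;
  lie_jacobi : forall a b c,
    lie a (lie b c) + lie b (lie c a) + lie c (lie a b) = 0;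
  lie_bounded : exists2 t : R, 0 < t &
    forall a b, `|lie a b| <= t%:C * `|a| * `|b|
}.

#[short(type="banachLieType")]
HB.structure Definition BanachLie (R : realType) :=
  {L of isBanachLie R L & CompleteNormedModule R[i] L}.

Section lie_theory.
Context {R : realType} {L : banachLieType R}.
Implicit Types (S I : set L).

Definition linear_subspace S :=
  S 0 /\ forall (k : R[i]) x y, S x -> S y -> S (k *: x + y).

Definition closed_lie_subalgebra S :=
  [/\ linear_subspace S, closed S & forall a b, S a -> S b -> S (lie a b)].

Definition closed_lie_ideal I :=
  [/\ linear_subspace I, closed I & forall a b, I b -> I (lie a b)].

(* dim (L / S) is finite: finitely many vectors span L modulo S *)
Definition finite_codim S :=
  exists (n : nat) (e : 'I_n -> L),
    forall x, exists c : 'I_n -> R[i], S (x - \sum_i c i *: e i).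

Lemma ideal_subalgebra I : closed_lie_ideal I -> closed_lie_subalgebra I.
Proof. by case=> sI cI lI; split=> // a b _; exact: lI. Qed.

End lie_theory.

(* Closed Lie subalgebras and closed Lie ideals, bundled so that they can be   *)
(* viewed as Banach Lie algebras and quotiented by, respectively.             *)
Record closed_subalg (R : realType) (L : banachLieType R) := ClosedSubalg {
  subalg_set :> set L;
  closed_subalgP : closed_lie_subalgebra subalg_set
}.

Record closed_ideal (R : realType) (L : banachLieType R) := ClosedIdeal {
  ideal_set :> set L;
  closed_idealP : closed_lie_ideal ideal_set
}.

Definition ideal_subalg (R : realType) (L : banachLieType R)
    (I : closed_ideal L) : closed_subalg L :=
  ClosedSubalg (ideal_subalgebra (closed_idealP I)).

Lemma closed_subalg_inj (R : realType) (L : banachLieType R)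
    (S T : closed_subalg L) : S = T :> set L -> S = T.
Proof.
case: S T => [S hS] [T hT] /= ST; rewrite ST in hS *.
by rewrite (Prop_irrelevance hS hT).
Qed.

(* A closed Lie subalgebra with the restricted operations and norm. *)
Section subalg_banach_lie.
Context {R : realType} {L : banachLieType R} (S : closed_subalg L).

Definition subalg_pred : {pred L} := fun x => x \in (S : set L).

Record subalg_type := SubalgElt {
  subalg_val : L;
  subalg_valP : subalg_pred subalg_val
}.

HB.instance Definition _ := [isSub of subalg_type for subalg_val].
HB.instance Definition _ := [Choice of subalg_type by <:].

Lemma subalg_submod : submod_closed subalg_pred.
Proof.
case: (closed_subalgP S) => -[S0 SD] _ _; split; first exact/mem_set.
by move=> k x y /set_mem Sx /set_mem Sy; apply/mem_set/SD.
Qed.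

HB.instance Definition _ := GRing.isSubmodClosed.Build _ _ subalg_pred subalg_submod.
HB.instance Definition _ := [SubChoice_isSubLmodule of subalg_type by <:].

Let nrm (x : subalg_type) : R[i] := `|val x|.

Let nrmD x y : nrm (x + y) <= nrm x + nrm y.
Proof. exact: ler_normD. Qed.

Let nrmZ k x : nrm (k *: x) = `|k| * nrm x.
Proof. exact: normrZ. Qed.

Let nrm0 x : nrm x = 0 -> x = 0.
Proof. by move=> /normr0_eq0 x0; exact: val_inj. Qed.

HB.instance Definition _ := Lmodule_isNormed.Build R[i] subalg_type
  nrmD nrmZ nrm0.

Lemma subalg_normE (x : subalg_type) : `|x| = `|val x|.
Proof. by []. Qed.

Let subalg_complete (F : set_system subalg_type) :
  ProperFilter F -> cauchy F -> cvg F.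
Proof.
move=> FF Fc.
have Gc : cauchy (val @ F : set_system L).
  apply/cauchy_ballP => e e0; have /cauchy_ballP/(_ e e0) := Fc.
  case=> -[A B] /= [FA FB] AB.
  exists (val @` A, val @` B) => /=.
    by split; [apply: filterS FA|apply: filterS FB] => x Ax /=; exists x.
  move=> [_ _] /= [[x Ax <-] [y By <-]].
  by have := AB (x, y) (conj Ax By); rewrite /= -!ball_normE.
have [l Gl] : exists l : L, (val @ F : set_system L) --> l.
  by apply/cvg_ex; exact: cauchy_cvg.
have Sl : subalg_pred l.
  case: (closed_subalgP S) => _ cS _; apply/mem_set.
  apply: cS => B /Gl FB; have [x Bx] := @filter_ex _ F _ (val @^-1` B) FB.
  by exists (val x); split=> //; exact/set_mem/subalg_valP.
apply/cvg_ex; exists (SubalgElt Sl); apply/cvgrPdist_lt => e e0.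
by move/cvgrPdist_lt : Gl => /(_ e e0).
Qed.

HB.instance Definition _ := Uniform_isComplete.Build subalg_type
  subalg_complete.

Lemma subalg_lie_subproof (x y : subalg_type) :
  subalg_pred (lie (val x) (val y)).
Proof.
case: (closed_subalgP S) => _ _ lS.
by apply/mem_set/lS; exact/set_mem/subalg_valP.
Qed.

Let slie (x y : subalg_type) : subalg_type :=
  SubalgElt (subalg_lie_subproof x y).

Let slie_linearl b : linear (slie ^~ b).
Proof. by move=> k x y; apply: val_inj; exact: lie_linearl. Qed.

Let slie_linearr a : linear (slie a).
Proof. by move=> k x y; apply: val_inj; exact: lie_linearr. Qed.

Let sliexx a : slie a a = 0.
Proof. by apply: val_inj; exact: liexx. Qed.

Let slie_jacobi a b c :
  slie a (slie b c) + slie b (slie c a) + slie c (slie a b) = 0.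
Proof. by apply: val_inj; exact: lie_jacobi. Qed.

Let slie_bounded : exists2 t : R, 0 < t &
  forall a b, `|slie a b| <= t%:C * `|a| * `|b|.
Proof.
have [t t0 tP] := @lie_bounded R L.
by exists t => // a b; exact: tP.
Qed.

HB.instance Definition _ := isBanachLie.Build R subalg_type
  slie_linearl slie_linearr sliexx slie_jacobi slie_bounded.

End subalg_banach_lie.

(* The quotient by a closed Lie ideal, with the quotient norm                 *)
(* |x| = inf {|y| : y in the coset x}; norms take values in R[i], so the      *)
(* infimum is taken over their real parts.                                    *)
Section quotient_banach_lie.
Context {R : realType} {L : banachLieType R} (I : closed_ideal L).

Definition ideal_pred : {pred L} := fun x => x \in (I : set L).

Lemma ideal_submod : submod_closed ideal_pred.
Proof.
case: (closed_idealP I) => -[S0 SD] _ _; split; first exact/mem_set.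
by move=> k x y /set_mem Sx /set_mem Sy; apply/mem_set/SD.
Qed.

HB.instance Definition _ := GRing.isSubmodClosed.Build _ _ ideal_pred
  ideal_submod.

Definition quotient_type : Type := {ideal_quot ideal_pred}.
Local Notation Q := quotient_type.

HB.instance Definition _ := Choice.on Q.
HB.instance Definition _ := GRing.Zmodule.on Q.

Definition quotient_proj (x : L) : Q := \pi_{ideal_quot ideal_pred} x.
Local Notation proj := quotient_proj.

Lemma quotient_projD x y : proj (x + y) = proj x + proj y.
Proof. by rewrite /proj raddfD. Qed.

Lemma quotient_projB x y : proj (x - y) = proj x - proj y.
Proof. by rewrite /proj raddfB. Qed.

Lemma quotient_projE x y : proj x = proj y <-> ideal_set I (x - y).
Proof.
rewrite /proj; split.
  by move=> /eqP; rewrite -Quotient.idealrBE => /set_mem.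
by move=> /mem_set Ixy; apply/eqP; rewrite -Quotient.idealrBE.
Qed.

Lemma quotient_projP (x : Q) : exists y, proj y = x.
Proof. by exists (repr x); rewrite /proj reprK. Qed.

Let lift (x : Q) : L := repr x.

Let liftK x : proj (lift x) = x.
Proof. by rewrite /proj /lift reprK. Qed.

Let scale (k : R[i]) (x : Q) : Q := proj (k *: lift x).

Let scaleE k y : scale k (proj y) = proj (k *: y).
Proof.
apply/quotient_projE; rewrite -scalerBr; case: (closed_idealP I) => -[I0 ID] _ _.
rewrite -[_ *: _]addr0; apply: ID => //.
by apply/quotient_projE; rewrite liftK.
Qed.

Let scaleA a b x : scale a (scale b x) = scale (a * b) x.
Proof. by have [y <-] := quotient_projP x; rewrite !scaleE scalerA. Qed.

Let scale1 : left_id 1 scale.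
Proof. by move=> x; have [y <-] := quotient_projP x; rewrite scaleE scale1r. Qed.

Let scaleDr : right_distributive scale +%R.
Proof.
move=> k x x'; have [y <-] := quotient_projP x; have [y' <-] := quotient_projP x'.
by rewrite -quotient_projD !scaleE scalerDr quotient_projD.
Qed.

Let scaleDl x : {morph scale^~ x : a b / a + b}.
Proof.
move=> a b; have [y <-] := quotient_projP x.
by rewrite !scaleE scalerDl quotient_projD.
Qed.

HB.instance Definition _ := GRing.Zmodule_isLmodule.Build R[i] Q
  scaleA scale1 scaleDr scaleDl.

Lemma quotient_projZ k y : proj (k *: y) = k *: proj y.
Proof. by rewrite -scaleE. Qed.

Definition quotient_norm (x : Q) : R :=
  inf [set complex.Re `|y| | y in [set y : L | proj y = x]].

Let N (y : L) : R := complex.Re `|y|.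

Let NE y : `|y| = (N y)%:C.
Proof. by rewrite /N RRe_real // normr_real. Qed.

Let N_ge0 y : 0 <= N y.
Proof. by rewrite -ler0c -NE. Qed.

Let ND x y : N (x + y) <= N x + N y.
Proof. by rewrite -lecR rmorphD /= -!NE ler_normD. Qed.

Let NZ k y : N (k *: y) = complex.Re `|k| * N y.
Proof.
apply: complexI; rewrite [RHS]rmorphM -!NE normrZ; congr (_ * _).
by symmetry; exact/RRe_real/normr_real.
Qed.

Let q_le y : quotient_norm (proj y) <= N y.
Proof.
apply: ge_inf; last by exists y.
by exists 0 => _ [z _ <-]; exact: N_ge0.
Qed.

Let q_lb r x : (forall y, proj y = x -> r <= N y) -> r <= quotient_norm x.
Proof.
move=> rN; apply: lb_le_inf.
  by have [y yx] := quotient_projP x; exists (N y); exists y.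
by move=> _ [y yx <-]; exact: rN.
Qed.

Let q_lbM c r x : 0 <= c -> (forall y, proj y = x -> r <= c * N y) ->
  r <= c * quotient_norm x.
Proof.
rewrite le_eqVlt => /predU1P[<-|c0] rN.
  by have [y yx] := quotient_projP x; have := rN y yx; rewrite !mul0r.
rewrite mulrC -ler_pdivrMr//; apply: q_lb => y yx.
by rewrite ler_pdivrMr// mulrC; exact: rN.
Qed.

Let q_ge0 x : 0 <= quotient_norm x.
Proof. by apply: q_lb => y _; exact: N_ge0. Qed.

Let q_lt x r : quotient_norm x < r -> exists2 y, proj y = x & N y < r.
Proof.
move=> qr; apply: contrapT => h; move: qr; rewrite ltNge => /negP; apply.
apply: q_lb => y yx; rewrite leNgt; apply/negP => yr.
by apply: h; exists y.
Qed.

Let nrm (x : Q) : R[i] := (quotient_norm x)%:C.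

Let nrmD x y : nrm (x + y) <= nrm x + nrm y.
Proof.
rewrite /nrm -rmorphD /= lecR -lerBlDr; apply: q_lb => u <-.
rewrite lerBlDr -lerBlDl; apply: q_lb => v <-.
by rewrite lerBlDl -quotient_projD (le_trans (q_le _)).
Qed.

Let qZ_le k x : quotient_norm (k *: x) <= complex.Re `|k| * quotient_norm x.
Proof.
apply: q_lbM => [|y <-]; first by rewrite -ler0c RRe_real ?normr_real.
by rewrite -NZ -quotient_projZ q_le.
Qed.

Let nrmZ k x : nrm (k *: x) = `|k| * nrm x.
Proof.
have Rek (z : R[i]) : (complex.Re `|z|)%:C = `|z|.
  by rewrite RRe_real ?normr_real.
apply: le_anti; apply/andP; split.
  by rewrite -[`|k|]Rek -rmorphM /= lecR qZ_le.
have [->|k0] := eqVneq k 0; first by rewrite normr0 mul0r ler0c q_ge0.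
rewrite mulrC -ler_pdivlMr ?normr_gt0// mulrC -normfV -[`|k^-1|]Rek.
rewrite -rmorphM /= lecR -[X in quotient_norm X <= _]scale1r -(mulVf k0).
by rewrite -scalerA qZ_le.
Qed.

Let nrm0 x : nrm x = 0 -> x = 0.
Proof.
move=> /complexI qx0; have [y yx] := quotient_projP x.
rewrite -yx -[0](_ : proj 0 = 0); last by rewrite /proj raddf0.
apply/quotient_projE; rewrite subr0.
case: (closed_idealP I) => _ cI _; apply: cI => B /nbhs_ballP[e /= e0 eB].
have eE : e = (complex.Re e)%:C by rewrite RRe_real// gtr0_real.
have e1 : 0 < complex.Re e by rewrite -ltcR -eE.
have [z zx ze] : exists2 z, proj z = x & N z < complex.Re e.
  by apply: q_lt; rewrite qx0.
exists (y - z); split; first by apply/quotient_projE; rewrite yx zx.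
by apply: eB; rewrite -ball_normE /= subKr NE eE ltcR.
Qed.

HB.instance Definition _ := Lmodule_isNormed.Build R[i] Q nrmD nrmZ nrm0.

Lemma quotient_normE (x : Q) : `|x| = (quotient_norm x)%:C.
Proof. by []. Qed.

Let proj_norm_le y : `|proj y| <= `|y|.
Proof. by rewrite quotient_normE NE lecR q_le. Qed.

Let lift_lt (x : Q) (r : R[i]) : `|x| < r -> exists2 y, proj y = x & `|y| < r.
Proof.
move=> xr; have rE : r = (complex.Re r)%:C.
  by rewrite RRe_real// gtr0_real// (le_lt_trans _ xr).
move: xr; rewrite quotient_normE rE ltcR => /q_lt[y yx yr].
by exists y => //; rewrite NE ltcR.
Qed.

Let small (e : R[i]) : 0 < e -> exists n : nat, 4 * 2 ^- n < e.
Proof.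
move=> e0; have eE : e = (complex.Re e)%:C by rewrite RRe_real// gtr0_real.
have e1 : 0 < complex.Re e / 4 by rewrite divr_gt0// -ltcR -eE.
have [n _ /(_ n (leqnn n)) /= nP] := near_infty_natSinv_expn_lt (PosNum e1).
exists n; rewrite -ltr_pdivlMl// mulrC eE.
move: nP; rewrite div1r -ltcR rmorphM !fmorphV /= rmorphXn /= !rmorph_nat.
by [].
Qed.

Let quotient_complete (F : set_system Q) :
  ProperFilter F -> cauchy F -> cvg F.
Proof.
move=> FF Fc.
have d0 n : 0 < 2 ^- n :> R[i] by rewrite invr_gt0 exprn_gt0.
have xex n : exists x : Q, F (ball x (2 ^- n)).
  by have /cauchyP := Fc; exact.
have /choice[x xP] := xex.
have xS n : `|x n - x n.+1| < 2 * 2 ^- n.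
  have [z [zn zn1]] := @filter_ex _ F _ _ (filterI (xP n) (xP n.+1)).
  move: zn zn1; rewrite -!ball_normE /= => zn zn1.
  rewrite mulr_natl mulr2n (le_lt_trans (ler_distD z _ _))// ltrD//.
  rewrite distrC (lt_le_trans zn1)// lef_pV2 ?posrE ?exprn_gt0//.
  by rewrite ler_eXn2l// ltr1n.
have step n (y : {y | proj y = x n}) :
    {y' : {y | proj y = x n.+1} | `|sval y - sval y'| < 2 * 2 ^- n}.
  apply: cid; case: y => y yx /=; have [w wx wn] := lift_lt (xS n).
  have yw : proj (y - w) = x n.+1 by rewrite quotient_projB yx wx subKr.
  by exists (exist _ (y - w) yw); rewrite /= subKr.
pose y0 : {y | proj y = x 0%N} := exist _ _ (liftK (x 0%N)).
pose ys := nat_rect (fun n => {y | proj y = x n}) y0 (fun n y => sval (step n y)).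
pose y n := sval (ys n).
have yx n : proj (y n) = x n by exact: (svalP (ys n)).
have yS n : `|y n - y n.+1| < 2 * 2 ^- n by exact: (svalP (step n (ys n))).
have yD n k : `|y n - y (n + k)%N| <= 4 * (2 ^- n - 2 ^- (n + k)).
  elim: k => [|k IH]; first by rewrite addn0 !subrr normr0 mulr0.
  rewrite (le_trans (ler_distD (y (n + k)%N) _ _))// addnS.
  rewrite (le_trans (lerD IH (ltW (yS _))))//.
  rewrite exprSr invfM.
  move: (2 ^- n) (2 ^- (n + k)) => a b.
  by rewrite (_ : 4 * (a - b) + 2 * b = 4 * (a - b * 2^-1))//; field.
have yc n m : (n <= m)%N -> `|y n - y m| < 4 * 2 ^- n.
  move=> /subnKC <-; rewrite (le_lt_trans (yD _ _))//.
  by rewrite ltr_pM2l// gtrBl.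
have [l yl] : exists l : L, y @ \oo --> l.
  apply/cvg_ex; apply: cauchy_cvg; apply: cauchy_exP => e e0.
  have [n ne] := small e0; exists (y n); exists n => // m /= nm.
  by rewrite -ball_normE /= (lt_trans (yc _ _ nm)).
apply/cvg_ex; exists (proj l); apply/cvgrPdist_lt => e e0.
have e2 : 0 < e / 2 by rewrite divr_gt0.
have [n ne] := small e2.
have [m nm lm] : exists2 m : nat, (n <= m)%N & `|l - y m| < e / 2.
  move/cvgrPdist_lt : yl => /(_ _ e2)[k _ km].
  by exists (maxn n k); [exact: leq_maxl|apply: km; exact: leq_maxr].
apply: filterS (xP m) => z; rewrite -ball_normE /= => xz.
rewrite (le_lt_trans (ler_distD (x m) _ _))// [ltRHS]splitr ltrD//.
  by rewrite -yx -quotient_projB (le_lt_trans (proj_norm_le _)).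
rewrite (lt_trans xz)// (le_lt_trans _ ne)//.
rewrite -[leLHS]mul1r ler_pM ?ler1n ?(ltW (d0 _)) ?ler01//.
by rewrite lef_pV2 ?posrE ?exprn_gt0// ler_eXn2l ?ltr1n.
Qed.

HB.instance Definition _ := Uniform_isComplete.Build Q quotient_complete.

Let qlie (x y : Q) : Q := proj (lie (lift x) (lift y)).

Let qlieE x y : qlie (proj x) (proj y) = proj (lie x y).
Proof.
have hB (f : L -> L) (u v : L) : linear f -> f (u - v) = f u - f v.
  by move=> fL; rewrite -[u - v]addrC -scaleN1r fL scaleN1r addrC.
case: (closed_idealP I) => -[I0 ID] _ Il.
have lI (u v : L) : proj u = proj v -> forall w, ideal_set I (lie w (u - v)).
  by move=> /quotient_projE uv w; exact: Il.
have anti (u v : L) : lie u v = - lie v u.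
  apply/eqP; rewrite -addr_eq0; apply/eqP; have := liexx (u + v).
  have lD w a b : lie w (a + b) = lie w a + lie w b.
    by rewrite -[a]scale1r lie_linearr !scale1r.
  have rD w a b : lie (a + b) w = lie a w + lie b w.
    by rewrite -[a]scale1r (lie_linearl w) !scale1r.
  by rewrite lD !rD !liexx add0r addr0 addrC.
rewrite /qlie; transitivity (proj (lie (lift (proj x)) y)).
  apply/quotient_projE; rewrite -(hB _ _ _ (@lie_linearr _ _ _)).
  by apply: lI; rewrite liftK.
apply/quotient_projE; rewrite -(hB _ _ _ (@lie_linearl _ _ y)) anti -scaleN1r.
rewrite -[_ *: _]addr0; apply: ID => //.
by apply: lI; rewrite liftK.
Qed.

Let qlie_linearl b : linear (qlie ^~ b).
Proof.
move=> k x y; have [x' <-] := quotient_projP x.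
have [y' <-] := quotient_projP y; have [b' <-] := quotient_projP b.
rewrite -quotient_projZ -quotient_projD !qlieE lie_linearl.
by rewrite quotient_projD quotient_projZ.
Qed.

Let qlie_linearr a : linear (qlie a).
Proof.
move=> k x y; have [x' <-] := quotient_projP x.
have [y' <-] := quotient_projP y; have [a' <-] := quotient_projP a.
rewrite -quotient_projZ -quotient_projD !qlieE lie_linearr.
by rewrite quotient_projD quotient_projZ.
Qed.

Let proj0 : proj 0 = 0. Proof. by rewrite /proj raddf0. Qed.

Let qliexx a : qlie a a = 0.
Proof. by have [a' <-] := quotient_projP a; rewrite qlieE liexx proj0. Qed.

Let qlie_jacobi a b c :
  qlie a (qlie b c) + qlie b (qlie c a) + qlie c (qlie a b) = 0.
Proof.
have [a' <-] := quotient_projP a; have [b' <-] := quotient_projP b.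
have [c' <-] := quotient_projP c.
by rewrite !qlieE -!quotient_projD lie_jacobi proj0.
Qed.

Let qlie_bounded : exists2 t : R, 0 < t &
  forall a b, `|qlie a b| <= t%:C * `|a| * `|b|.
Proof.
have [t t0 tP] := @lie_bounded R L; exists t => // a b.
rewrite !quotient_normE -!rmorphM /= lecR; apply: q_lbM => [|v <-].
  by rewrite mulr_ge0// ltW.
rewrite mulrAC; apply: q_lbM => [|u <-]; first by rewrite mulr_ge0// ltW.
rewrite qlieE (le_trans (q_le _))// mulrAC -lecR !rmorphM /= -!NE.
exact: tP.
Qed.

HB.instance Definition _ := isBanachLie.Build R Q
  qlie_linearl qlie_linearr qliexx qlie_jacobi qlie_bounded.

Lemma quotient_lieE x y : lie (proj x) (proj y) = proj (lie x y).
Proof. exact: qlieE. Qed.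

End quotient_banach_lie.

Section subalg_constructions.
Context {R : realType} {L : banachLieType R}.

Lemma setT_subalgebra : closed_lie_subalgebra [set: L].
Proof. by split=> //; exact: closedT. Qed.

Definition top_subalg : closed_subalg L := ClosedSubalg setT_subalgebra.

Lemma bigcap_subalgebra (F : set (set L)) :
  F `<=` @closed_lie_subalgebra R L ->
  closed_lie_subalgebra (\bigcap_(S in F) S).
Proof.
move=> FS; split.
- split=> [S /FS[[]]//|k x y Fx Fy S FS'].
  by case: (FS _ FS') => -[_ SD] _ _; apply: SD; [exact: Fx|exact: Fy].
- by apply: closed_bigI => S /FS[].
- move=> a b Fa Fb S FS'.
  by case: (FS _ FS') => _ _; apply; [exact: Fa|exact: Fb].
Qed.

Definition bigcap_subalg (F : set (set L))
    (FS : F `<=` @closed_lie_subalgebra R L) : closed_subalg L :=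
  ClosedSubalg (bigcap_subalgebra FS).

Lemma subalg_range_subproof (J : Type) (T : J -> closed_subalg L) :
  [set subalg_set (T j) | j in setT] `<=` @closed_lie_subalgebra R L.
Proof. by move=> _ [j _ <-]; exact: closed_subalgP. Qed.

Definition cap_subalg (J : Type) (T : J -> closed_subalg L) : closed_subalg L :=
  bigcap_subalg (@subalg_range_subproof J T).

Lemma image_subalgebra (S : closed_subalg L) (T : closed_subalg (subalg_type S)) :
  closed_lie_subalgebra (@subalg_val R L S @` T).
Proof.
case: (closed_subalgP T) => -[T0 TD] Tc Tl; split.
- split; first by exists 0.
  move=> k _ _ [x Tx <-] [y Ty <-]; exists (k *: x + y) => //; exact: TD.
- move=> x xT; have Sx : subalg_pred S x.
    case: (closed_subalgP S) => _ Sc _; apply/mem_set/Sc => B /xT.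
    move=> [_ [[u Tu <-] Bu]]; exists (subalg_val u); split=> //.
    exact/set_mem/subalg_valP.
  exists (SubalgElt Sx) => //; apply: Tc => B /nbhs_ballP[e /= e0 eB].
  have [_ [[u Tu <-] ue]] := xT _ (nbhsx_ballx x e e0).
  by exists u; split=> //; apply: eB; move: ue; rewrite -!ball_normE.
- move=> _ _ [x Tx <-] [y Ty <-]; exists (lie x y) => //; exact: Tl.
Qed.

(* a subalgebra of a subalgebra, seen inside the ambient algebra *)
Definition image_subalg (S : closed_subalg L) (T : closed_subalg (subalg_type S))
  : closed_subalg L := ClosedSubalg (image_subalgebra T).

End subalg_constructions.
Arguments top_subalg {R} L.

(* Ordinals, as well-founded trees; Osup f is the least upper bound of the    *)
(* family f. Two trees denote the same ordinal when each is <= the other.     *)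
Inductive ordinal_tree : Type :=
  | Ozero
  | Osucc of ordinal_tree
  | Osup (J : Type) of (J -> ordinal_tree).

Fixpoint ole (a : ordinal_tree) : ordinal_tree -> Prop :=
  match a with
  | Ozero => fun=> True
  | Osucc a' => fix lta' (b : ordinal_tree) : Prop :=
      match b with
      | Ozero => False
      | Osucc b' => ole a' b'
      | Osup J g => exists j, lta' (g j)
      end
  | Osup J f => fun b => forall j, ole (f j) b
  end.

Definition olt a b := ole (Osucc a) b.

Lemma ole_sup_r J (g : J -> ordinal_tree) j a : ole a (g j) -> ole a (Osup g).
Proof.
elim: a => [//|a IH|K f IH] /=; first by exists j.
by move=> h k; apply: IH.
Qed.

Lemma ole_refl a : ole a a.
Proof.
by elim: a => [//|a //|J f IH] /= j; apply: ole_sup_r; exact: IH.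
Qed.

Lemma ole_trans b a c : ole a b -> ole b c -> ole a c.
Proof.
elim: b a c => [|b IHb|J g IHg].
- elim=> [//|//|K f IH] c /= h _ k; exact: (IH k c (h k)).
- elim=> [//|a IHa|K f IH] c; last by move=> /= h bc k; exact: (IH k c (h k)).
  elim: c => [//|c _|K f IH] /=; first exact: IHb.
  by move=> ab [k bf]; exists k; exact: IH.
- elim=> [//|a IHa|K f IH] c; last by move=> /= h bc k; exact: (IH k c (h k)).
  by move=> [j aj] gc; exact: (IHg j (Osucc a) c aj (gc j)).
Qed.

Lemma olt_le_trans b a c : olt a b -> ole b c -> olt a c.
Proof. exact: ole_trans. Qed.

Lemma ole_succ a : ole a (Osucc a).
Proof.
elim: a => [//|a IH|J f IH] /=; first exact: IH.
move=> j; apply: (ole_trans (IH j)) => /=.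
exact/ole_sup_r/ole_refl.
Qed.

Lemma oltW a b : olt a b -> ole a b.
Proof. exact/ole_trans/ole_succ. Qed.

Lemma olt_wf : well_founded olt.
Proof.
move=> b; suff: forall c, ole c b -> Acc olt c by apply; exact: ole_refl.
elim: b => [|b IH|J g IH] c cb; apply: Acc_intro => d dc.
- by have := olt_le_trans dc cb.
- exact: IH (olt_le_trans dc cb).
- have [j dj] := olt_le_trans dc cb; exact: IH (oltW dj).
Qed.

Lemma olt_irr a : ~ olt a a.
Proof. by elim/(well_founded_ind olt_wf): a => a IH aa; exact: (IH a aa aa). Qed.

Lemma ole_total a b : ole a b \/ olt b a.
Proof.
elim: a b => [|a IHa|J f IHf] b; first by left.
- elim: b => [|b _|K g IHg]; first by right.
    by case: (IHa b) => ab; [left|right].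
  have [[k ak]|h] := pselect (exists k, ole (Osucc a) (g k)).
    by left; exists k.
  right => /= k; case: (IHg k) => // ak; by case: h; exists k.
- have [h|/existsNP[j fj]] := pselect (forall j, ole (f j) b); first by left.
  by case: (IHf j b) => // bj; right; exists j.
Qed.

(* A map P assigning a closed Lie subalgebra to every Banach Lie algebra.     *)
(* Closed ideals are the case of interest, but P^a(L) is in general only a    *)
(* subalgebra of L.                                                           *)
Definition lie_map (R : realType) :=
  forall L : banachLieType R, closed_subalg L.

Section transfinite_powers.
Context {R : realType} (P : lie_map R) (L : banachLieType R).

(* P(S), as a subalgebra of L *)
Definition lie_map_step (S : closed_subalg L) : closed_subalg L :=
  image_subalg (P (subalg_type S)).

Fixpoint lie_power (a : ordinal_tree) : closed_subalg L :=
  match a with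
  | Ozero => top_subalg L
  | Osucc b => lie_map_step (lie_power b)
  | Osup J f => cap_subalg (fun j => lie_power (f j))
  end.

Lemma lie_map_step_sub S : (lie_map_step S : set L) `<=` S.
Proof. by move=> _ [x _ <-]; exact/set_mem/subalg_valP. Qed.

Lemma lie_power_supE J (f : J -> ordinal_tree) :
  lie_power (Osup f) = \bigcap_j (lie_power (f j) : set L) :> set L.
Proof.
apply/seteqP; split=> x /= fx.
  by move=> j _; apply: fx; exists j.
by move=> _ [j _ <-]; exact: fx.
Qed.

Lemma lie_power_antitone a b : ole a b ->
  (lie_power b : set L) `<=` lie_power a.
Proof.
suff: forall c a b, ole a c -> ole b c -> ole a b ->
    (lie_power b : set L) `<=` lie_power a.
  by move=> h ab; apply: (h b) => //; exact: ole_refl.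
move=> {a b} c; have := olt_wf c; elim=> {}c _ IHc a b.
elim: b a => [|b IHb|J g IHg].
- elim=> [//|//|K f IHf] ac bc ab; rewrite lie_power_supE => x xb j _.
  by apply: (IHf j) => //; exact: (ac j).
- elim=> [//|a _|K f IHf] ac bc ab; last first.
    rewrite [X in _ `<=` X]lie_power_supE => x xb j _.
    by exact: (IHf j (ac j) bc (ab j)).
  have [ba|lt_ab] := ole_total b a; last first.
    apply: subset_trans (IHb (Osucc a) ac (oltW bc) lt_ab).
    exact: lie_map_step_sub.
  have {}ab : ole a b by [].
  suff pab : lie_power a = lie_power b by rewrite /= pab.
  apply: closed_subalg_inj; apply/seteqP; split.
    by apply: (IHc b bc) => //; exact: ole_refl.
  by apply: (IHc b bc) => //; exact: ole_refl.
- elim=> [//|a _|K f IHf] ac bc ab; last first.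
    rewrite [X in _ `<=` X]lie_power_supE => x xb j _.
    by exact: (IHf j (ac j) bc (ab j)).
  have [j aj] := ab; rewrite lie_power_supE => x xg.
  by apply: (IHg j (Osucc a) ac (bc j) aj); exact: xg.
Qed.

Lemma lie_power_eq a b : ole a b -> ole b a -> lie_power a = lie_power b.
Proof.
move=> ab ba; apply: closed_subalg_inj.
by apply/seteqP; split; exact: lie_power_antitone.
Qed.

Lemma lie_power_limit a x : olt Ozero a ->
    (forall b, olt b a -> olt (Osucc b) a) ->
  subalg_set (lie_power a) x <->
  forall b, olt b a -> subalg_set (lie_power b) x.
Proof.
move=> a0 alim; split.
  by move=> xa b /oltW /lie_power_antitone; exact.
elim: a a0 alim => [//|a _|J f IH] a0 alim.
  have aa : olt a (Osucc a) by exact: ole_refl.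
  by have /olt_irr := alim _ aa.
move=> xa; rewrite lie_power_supE => j _.
have [fle|flt] := ole_total (Osup f) (f j); last exact: xa.
have fj : ole (f j) (Osup f) by exact/ole_sup_r/ole_refl.
apply: IH => [|b bf|b bf].
- exact: olt_le_trans fle.
- exact: olt_le_trans (alim _ (olt_le_trans bf fj)) fle.
- by apply: xa; exact: olt_le_trans fj.
Qed.

Definition lie_power_stable a := lie_power (Osucc a) = lie_power a.

Lemma lie_power_stabilizes : exists a, lie_power_stable a /\
  forall b, lie_power_stable b -> ole a b.
Proof.
have [a sa] : exists a, lie_power_stable a.
  pose J := {T : closed_subalg L | exists a, lie_power a = T}.
  pose g (j : J) : ordinal_tree := sval (cid (svalP j)).
  have gP j : lie_power (g j) = sval j := svalP (cid (svalP j)).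
  pose f (j : J) := Osucc (g j).
  exists (Osup f); apply: closed_subalg_inj; apply/seteqP; split.
    exact: lie_map_step_sub.
  pose j : J := exist _ (lie_power (Osucc (Osup f))) (ex_intro _ _ erefl).
  have fj : ole (f j) (Osup f) by exact/ole_sup_r/ole_refl.
  have := subset_trans (lie_power_antitone fj) (@lie_map_step_sub (lie_power (g j))).
  by rewrite (gP j).
elim/(well_founded_ind olt_wf): a sa => a IH sa.
have [h|/existsNP[b /not_implyP[sb ab]]] :=
  pselect (forall b, lie_power_stable b -> ole a b); first by exists a.
by apply: (IH b) => //; case: (ole_total a b).
Qed.

(* the least ordinal at which the chain of powers is stationary *)
Definition stable_ordinal : ordinal_tree := sval (cid lie_power_stabilizes).

End transfinite_powers.

Definition lie_closure (R : realType) (P : lie_map R) : lie_map R :=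
  fun L => lie_power P L (stable_ordinal P L).

Section radicals.
Context {R : realType}.

Definition lie_morphism (L M : banachLieType R) (f : {linear L -> M}) :=
  [/\ forall a b, f (lie a b) = lie (f a) (f b),
      exists k : R, forall x, `|f x| <= k%:C * `|x|
    & dense (range f)].

Definition preradical (P : lie_map R) :=
  (forall L, closed_lie_ideal (P L)) /\
  (forall (L M : banachLieType R) (f : {linear L -> M}),
     lie_morphism f -> f @` P L `<=` P M).

Definition lower_stable (P : lie_map R) :=
  forall L, lie_map_step P (P L) = P L.

Definition upper_stable (P : lie_map R) :=
  forall L (PL : closed_lie_ideal (P L)),
    P (quotient_type (ClosedIdeal PL)) = [set 0] :> set _.

Definition balanced (P : lie_map R) :=
  forall (L : banachLieType R) (I : closed_ideal L),
    (lie_map_step P (ideal_subalg I) : set L) `<=` P L.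

Definition radical (P : lie_map R) :=
  [/\ preradical P, lower_stable P, upper_stable P & balanced P].

End radicals.

Section families.
Context {R : realType} (L : banachLieType R).

Definition finite_codim_subalgebras : set (set L) :=
  [set S | [/\ closed_lie_subalgebra S, S <> setT & finite_codim S]].

Definition finite_codim_ideals : set (set L) :=
  [set I | [/\ closed_lie_ideal I, I <> setT & finite_codim I]].

Definition maximal_members (F : set (set L)) : set (set L) :=
  [set S | F S /\ forall T, F T -> S `<=` T -> T = S].

Lemma finite_codim_subalgebras_sub :
  finite_codim_subalgebras `<=` @closed_lie_subalgebra R L.
Proof. by move=> S []. Qed.

Lemma finite_codim_ideals_sub :
  finite_codim_ideals `<=` @closed_lie_subalgebra R L.
Proof. by move=> I [/ideal_subalgebra]. Qed.

Lemma maximal_members_sub (F : set (set L)) : maximal_members F `<=` F.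
Proof. by move=> S []. Qed.

End families.

(* Intersections over the four families; \bigcap over an empty family is setT *)
Section frattini_maps.
Context (R : realType).

Definition P_S : lie_map R := fun L =>
  bigcap_subalg (@finite_codim_subalgebras_sub R L).

Definition P_Smax : lie_map R := fun L =>
  bigcap_subalg (subset_trans (@maximal_members_sub R L _)
    (@finite_codim_subalgebras_sub R L)).

Definition P_J : lie_map R := fun L =>
  bigcap_subalg (@finite_codim_ideals_sub R L).

Definition P_Jmax : lie_map R := fun L =>
  bigcap_subalg (subset_trans (@maximal_members_sub R L _)
    (@finite_codim_ideals_sub R L)).

End frattini_maps.
Arguments P_S {R} L.
Arguments P_Smax {R} L.
Arguments P_J {R} L.
Arguments P_Jmax {R} L.

(* Main.v *)
(* The key point is that a maximal closed subalgebra S of finite codimension  *)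
(* contains a closed ideal of finite codimension. If S is not an ideal, then  *)
(* L = S + [S, L]: otherwise a functional f killing S and [S, L] would make   *)
(* f [x, y] an S-invariant symplectic form on L / S, and the vector           *)
(* representing f would normalise S. Filter S by the subspaces L_n of those x *)
(* which products of fewer than n operators ad y map into S. On the           *)
(* associated graded space the operators ad y, for y in L / S, commute and    *)
(* lower the degree. For h in S the eigenvalues of ad h on every graded piece *)
(* are bounded by the norm of ad h, so a root vector of ad h in L / S of root *)
(* l <> 0, which shifts eigenvalues by l, acts nilpotently. The span W of S   *)
(* and of all the root vectors is S-invariant (apply exp (ad k), k in S), and *)
(* S acts nilpotently on L / W; Engel's theorem and L = S + [S, L] give       *)
(* W = L. Hence all long products vanish on the graded space, the filtration  *)
(* is stationary, and its last term is the ideal sought.                      *)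
(*                                                                            *)
(* Bounded derivations D preserve the intersection of the maximal             *)
(* subalgebras, because the automorphisms exp (t D) do. The four transfinite  *)
(* limits all coincide with the largest closed subalgebra without proper      *)
(* closed subalgebras of finite codimension, and this description yields the  *)
(* radical axioms.                                                            *)

Require Import Defs.
From HB Require Import structures.
From mathcomp Require Import all_boot all_order all_algebra.
From mathcomp Require Import complex.
From mathcomp Require Import all_classical all_reals.
From mathcomp Require Import topology normedtype sequences exp.
From mathcomp Require Import ring lra zify.

Set Implicit Arguments.
Unset Strict Implicit.
Unset Printing Implicit Defensive.

Import Order.TTheory GRing.Theory Num.Theory.
Import numFieldNormedType.Exports.

Local Open Scope classical_set_scope.
Local Open Scope complex_scope.
Local Open Scope ring_scope.

(** * Norms and sequences *)

(** Every maximal closed subalgebra [S] of finite codimension contains a closed ideal of finite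
    codimension ([maximal_contains_ideal]). This gives [P_J_sub_P_Smax] and, on enlarging that ideal
    to a maximal one, [P_Jmax_proper]. If [S] is not itself an ideal, the ideal is a term of the
    filtration [fil], once that is known to be stationary. On the graded space the operators ad y
    commute, so it suffices that each of finitely many vectors spanning L modulo [S] acts
    nilpotently there. Root vectors of ad h with h in [S] and nonzero root do, because a long
    product of them would move eigenvalues beyond the norm of ad h ([spectral_bound],
    [root_word_nil]). Together with [S] they span L, by [engel] and [maximal_invariant_functional]
    ([root_span_full]).

    [P_Smax L] is stable under bounded derivations D, because the automorphisms exp(tD) permute the
    maximal subalgebras ([exp_map_lie], [P_Smax_derivation]). Hence its transfinite powers are
    ideals ([ideal_power_P_Smax]). For a maximal ideal I, the ideal [P_Smax L] + I is I or L, and it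
    is not L because both summands lie in a common maximal subalgebra ([P_Smax_hom]).

    For P between [P_S] and [P_Jmax], P A = A holds exactly when A has no proper closed subalgebra
    of finite codimension. So the limit of the chain of P is the largest closed subalgebra with that
    property, whatever P is ([closure_perfect], [perfect_range_closure]). The radical axioms follow;
    for upper stability, an extension of such algebras is again of this kind. If the powers of P
    stay inside those of Q, the chain of P has reached the common limit as soon as that of Q has
    ([stable_ordinal_le]). *)

Section complex_modulus.
Context {R : realType}.
Implicit Types c d : R[i].

Definition cmod c : R := complex.Re `|c|.

Lemma cmodE c : `|c| = (cmod c)%:C.
Proof. by rewrite /cmod RRe_real // normr_real. Qed.

Lemma cmod_ge0 c : 0 <= cmod c.
Proof. by rewrite -ler0c -cmodE. Qed.

Lemma cmodM c d : cmod (c * d) = cmod c * cmod d.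
Proof. by apply: complexI; rewrite rmorphM /= -!cmodE normrM. Qed.

Lemma cmodV c : cmod c^-1 = (cmod c)^-1.
Proof. by apply: complexI; rewrite fmorphV /= -!cmodE normfV. Qed.

Lemma cmodX c n : cmod (c ^+ n) = cmod c ^+ n.
Proof. by apply: complexI; rewrite rmorphXn /= -!cmodE normrX. Qed.

Lemma cmod_eq0 c : (cmod c == 0) = (c == 0).
Proof. by rewrite -(inj_eq (@complexI R)) -cmodE normr_eq0. Qed.

Lemma cmod_gt0 c : (0 < cmod c) = (c != 0).
Proof. by rewrite lt_neqAle cmod_ge0 andbT eq_sym cmod_eq0. Qed.

Lemma cmodD c d : cmod (c + d) <= cmod c + cmod d.
Proof. by rewrite -lecR rmorphD /= -!cmodE ler_normD. Qed.

Lemma cmodN c : cmod (- c) = cmod c.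
Proof. by rewrite /cmod normrN. Qed.

Lemma cmod_nat n : cmod n%:R = n%:R.
Proof.
by apply: complexI; rewrite -cmodE normr_nat (_ : n%:R%:C = n%:R)// rmorph_nat.
Qed.

Lemma cmod_real (a : R) : cmod a%:C = `|a|.
Proof.
by apply: complexI; rewrite -cmodE normc_def /= expr0n addr0 sqrtr_sqr.
Qed.

Lemma cmodi : cmod ('i : R[i]) = 1.
Proof. by apply: complexI; rewrite -cmodE normc_def /= expr0n add0r expr1n sqrtr1. Qed.

Lemma ge_Re c : `|complex.Re c| <= cmod c.
Proof. by rewrite -lecR -cmodE normc_ge_Re. Qed.

Lemma ge_Im c : `|complex.Im c| <= cmod c.
Proof.
rewrite -[cmod c]mul1r -cmodi -cmodM -normrN.
rewrite (_ : - complex.Im c = complex.Re ('i * c)) ?ge_Re//.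
by case: c => a b /=; rewrite mul0r mul1r sub0r.
Qed.

Lemma real_complete (u : nat -> R) :
  (forall e : R, 0 < e -> exists n0, forall n m, (n0 <= n)%N -> (n0 <= m)%N ->
     `|u n - u m| < e) ->
  exists l, forall e : R, 0 < e -> exists n0, forall n, (n0 <= n)%N -> `|u n - l| < e.
Proof.
move=> uc; have [l ul] : exists l : R, u @ \oo --> l.
  apply/cvg_ex; apply: cauchy_cvg; apply: cauchy_exP => e e0.
  have [n0 h] := uc _ e0.
  exists (u n0); exists n0 => // m /= nm.
  by rewrite -ball_normE /=; exact: h.
exists l => e e0.
move/cvgrPdist_lt : ul => /(_ _ e0)[k _ km].
by exists k => n /km /=; rewrite distrC.
Qed.

Lemma complex_complete (u : nat -> R[i]) :
  (forall e : R, 0 < e -> exists n0, forall n m, (n0 <= n)%N -> (n0 <= m)%N ->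
     cmod (u n - u m) < e) ->
  exists l, forall e : R, 0 < e -> exists n0, forall n, (n0 <= n)%N -> cmod (u n - l) < e.
Proof.
move=> uc.
have [|a ha] := real_complete (u := fun n => complex.Re (u n)).
  move=> e /uc[n0 h]; exists n0 => n m nn mm; apply: le_lt_trans (h n m nn mm).
  by rewrite -raddfB ge_Re.
have [|b hb] := real_complete (u := fun n => complex.Im (u n)).
  move=> e /uc[n0 h]; exists n0 => n m nn mm; apply: le_lt_trans (h n m nn mm).
  by rewrite -raddfB ge_Im.
exists (a%:C + 'i * b%:C) => e e0; have e2 : 0 < e / 2 by rewrite divr_gt0.
have [na hna] := ha _ e2; have [nb hnb] := hb _ e2.
exists (maxn na nb) => n; rewrite geq_max => /andP[/hna h1 /hnb h2].
rewrite (_ : _ - _ = (complex.Re (u n) - a)%:C + 'i * (complex.Im (u n) - b)%:C).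
  by rewrite (le_lt_trans (cmodD _ _))// cmodM cmodi mul1r !cmod_real; lra.
by case: (u n) => c d; apply/eqP; rewrite eq_complex /=; apply/andP; split; apply/eqP; ring.
Qed.

Lemma harmonic_lt (e : R) : 0 < e -> exists n0 : nat, forall n, (n0 <= n)%N -> n.+1%:R^-1 < e.
Proof.
move=> e0; exists (Num.bound e^-1) => n nn.
have ei : 0 < e^-1 by rewrite invr_gt0.
rewrite -[ltRHS]invrK ltf_pV2 ?posrE ?ltr0n//.
rewrite (lt_le_trans (archi_boundP (ltW ei)))// ler_nat; exact: leqW.
Qed.

Lemma geometric_lt (r a e : R) : 0 <= r -> r < 1 -> 0 < e -> exists n, r ^+ n * a < e.
Proof.
move=> r0 r1 e0; have [a0|a0] := leP a 0.
  by exists 0%N; rewrite expr0 mul1r (le_lt_trans a0).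
have rr : `|r| < 1 by rewrite ger0_norm.
have := cvg_expr rr; move/cvgrPdist_lt => /(_ _ (divr_gt0 e0 a0))[n _ /(_ n (leqnn n))] /=.
rewrite sub0r normrN ger0_norm ?exprn_ge0// ltr_pdivlMr//; by exists n.
Qed.

End complex_modulus.

(** Norms take values in [R[i]]; the real part lets all estimates be made between reals. *)
Definition rnorm (R : realType) (V : normedModType R[i]) (x : V) : R :=
  complex.Re `|x|.

Section real_norm.
Context {R : realType} {V : normedModType R[i]}.
Implicit Types x y z : V.

Lemma normE x : `|x| = (rnorm x)%:C.
Proof. by rewrite /rnorm RRe_real // normr_real. Qed.

Lemma rnorm_ge0 x : 0 <= rnorm x.
Proof. by rewrite -ler0c -normE. Qed.

Lemma rnormD x y : rnorm (x + y) <= rnorm x + rnorm y.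
Proof. by rewrite -lecR rmorphD /= -!normE ler_normD. Qed.

Lemma rnormZ k x : rnorm (k *: x) = cmod k * rnorm x.
Proof. by apply: complexI; rewrite [RHS]rmorphM /= -cmodE -!normE normrZ. Qed.

Lemma rnormN x : rnorm (- x) = rnorm x.
Proof. by rewrite /rnorm normrN. Qed.

Lemma rnormB x y : rnorm (x - y) = rnorm (y - x).
Proof. by rewrite /rnorm distrC. Qed.

Lemma rnorm0 : rnorm (0 : V) = 0.
Proof. by rewrite /rnorm normr0. Qed.

Lemma rnorm_eq0 x : (rnorm x == 0) = (x == 0).
Proof. by rewrite -(inj_eq (@complexI R)) -normE normr_eq0. Qed.

Lemma rnorm_dist z x y : rnorm (x - y) <= rnorm (x - z) + rnorm (z - y).
Proof. by apply: le_trans (rnormD _ _); rewrite subrKA. Qed.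

Lemma rnorm_sum (I : Type) (r : seq I) (P : pred I) (F : I -> V) :
  rnorm (\sum_(i <- r | P i) F i) <= \sum_(i <- r | P i) rnorm (F i).
Proof.
elim/big_rec2: _ => [|i y x _ xy]; first by rewrite rnorm0.
by rewrite (le_trans (rnormD _ _))// lerD.
Qed.

Lemma ballE (x y : V) (e : R) : ball x e%:C y <-> rnorm (x - y) < e.
Proof. by rewrite -ball_normE /= normE ltcR. Qed.

Lemma closed_approxP (Z : set V) :
  closed Z <-> forall x, (forall e : R, 0 < e -> exists2 z, Z z & rnorm (x - z) < e) -> Z x.
Proof.
split=> [cZ x xZ|h x xZ].
  apply: cZ => B /nbhs_ballP[e /= e0 eB].
  have eE : e = (complex.Re e)%:C by rewrite RRe_real// gtr0_real.
  have e1 : 0 < complex.Re e by rewrite -ltcR -eE.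
  have [z Zz ze] := xZ _ e1; exists z; split => //.
  by apply: eB; rewrite eE; apply/ballE.
apply: h => e e0; have e1 : 0 < e%:C by rewrite ltcR.
by have [z [Zz /ballE]] := xZ _ (nbhsx_ballx x _ e1); exists z.
Qed.

Definition rcvg (u : nat -> V) (l : V) :=
  forall e : R, 0 < e -> exists n0, forall n, (n0 <= n)%N -> rnorm (u n - l) < e.

Lemma rcvg_unique u l l' : rcvg u l -> rcvg u l' -> l = l'.
Proof.
move=> ul ul'; apply/eqP; rewrite -subr_eq0 -rnorm_eq0 eq_le rnorm_ge0 andbT.
rewrite leNgt; apply/negP => ll'; have e0 : 0 < rnorm (l - l') / 2 by rewrite divr_gt0.
have [n0 hn0] := ul _ e0; have [n1 hn1] := ul' _ e0.
have := hn0 (maxn n0 n1) (leq_maxl _ _); have := hn1 (maxn n0 n1) (leq_maxr _ _).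
by have := rnorm_dist (u (maxn n0 n1)) l l'; rewrite (rnormB l (u _)); lra.
Qed.

Lemma rcvg_closed (Z : set V) u l : closed Z -> (forall n, Z (u n)) -> rcvg u l -> Z l.
Proof.
move=> /closed_approxP cZ Zu ul; apply: cZ => e /ul[n /(_ n (leqnn n))].
by rewrite rnormB; exists (u n).
Qed.

Lemma rcvg_le u l (b : nat -> R) :
  (forall n, rnorm (u n - l) <= b n) ->
  (forall e, 0 < e -> exists n0, forall n, (n0 <= n)%N -> b n < e) -> rcvg u l.
Proof. by move=> ub b0 e /b0[n0 h]; exists n0 => n /h; exact: le_lt_trans (ub n). Qed.

Lemma rcvgD u v l m : rcvg u l -> rcvg v m -> rcvg (fun n => u n + v n) (l + m).
Proof.
move=> ul vm e e0; have e20 : 0 < e / 2 by rewrite divr_gt0.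
have [n0 hn0] := ul _ e20; have [n1 hn1] := vm _ e20.
exists (maxn n0 n1) => n; rewrite geq_max => /andP[/hn0 h0 /hn1 h1].
rewrite opprD addrACA [ltRHS]splitr (le_lt_trans (rnormD _ _))// ltrD//.
Qed.

Lemma rcvg_cst l : rcvg (fun=> l) l.
Proof. by move=> e e0; exists 0%N => n _; rewrite subrr rnorm0. Qed.

Lemma rcvgZ k u l : rcvg u l -> rcvg (fun n => k *: u n) (k *: l).
Proof.
move=> ul e e0; have [->|k0] := eqVneq k 0.
  by exists 0%N => n _; rewrite !scale0r subrr rnorm0.
have k1 : 0 < cmod k by rewrite cmod_gt0.
have [n0 h] := ul _ (divr_gt0 e0 k1); exists n0 => n /h.
by rewrite ltr_pdivlMr// mulrC -rnormZ scalerBr.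
Qed.

Lemma rcvgN u l : rcvg u l -> rcvg (fun n => - u n) (- l).
Proof. by move=> ul e /ul[n0 h]; exists n0 => n /h; rewrite -opprD rnormN. Qed.

Lemma rcvgB u v l m : rcvg u l -> rcvg v m -> rcvg (fun n => u n - v n) (l - m).
Proof. by move=> ul vm; apply: rcvgD => //; exact: rcvgN. Qed.

Lemma rcvg_bound u l (b : R) : rcvg u l -> (forall n, rnorm (u n) <= b) -> rnorm l <= b.
Proof.
move=> ul ub; rewrite leNgt; apply/negP => bl.
have [n0 /(_ n0 (leqnn _))] := ul (rnorm l - b) (ltac:(lra)).
rewrite ltrBrDr => h; have := le_lt_trans (lerD (lexx (rnorm (u n0 - l))) (ub n0)) h.
rewrite ltNge rnormB => /negP; apply.
by have := rnormD (l - u n0) (u n0); rewrite subrK.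
Qed.

End real_norm.

Lemma rcvg_complete {R : realType} {V : completeNormedModType R[i]} (u : nat -> V) :
  (forall e : R, 0 < e -> exists n0, forall n m, (n0 <= n)%N -> (n0 <= m)%N ->
     rnorm (u n - u m) < e) ->
  exists l, rcvg u l.
Proof.
move=> uc; have [l ul] : exists l : V, u @ \oo --> l.
  apply/cvg_ex; apply: cauchy_cvg; apply: cauchy_exP => e e0.
  have eE : e = (complex.Re e)%:C by rewrite RRe_real// gtr0_real.
  have e1 : 0 < complex.Re e by rewrite -ltcR -eE.
  have [n0 h] := uc _ e1.
  exists (u n0); exists n0 => // m /= nm.
  by rewrite eE; apply/ballE; exact: h.
exists l => e e0; have e1 : 0 < e%:C by rewrite ltcR.
move/cvgrPdist_lt : ul => /(_ _ e1)[k _ km].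
by exists k => n /km /=; rewrite distrC normE ltcR.
Qed.

Section linear_maps.
Context {R : realType} {L M : normedModType R[i]}.

Definition bounded_map (f : L -> M) :=
  exists2 k : R, 0 <= k & forall x, rnorm (f x) <= k * rnorm x.

End linear_maps.

Lemma bounded_comp {R : realType} {L M N : normedModType R[i]} (f : M -> N) (g : L -> M) :
  bounded_map f -> bounded_map g -> bounded_map (f \o g).
Proof.
move=> [k k0 kP] [l l0 lP]; exists (k * l); rewrite ?mulr_ge0// => x /=.
by rewrite (le_trans (kP _))// -mulrA ler_wpM2l.
Qed.

Lemma closed_preimage_bounded {R : realType} {L M : normedModType R[i]}
    (f : {linear L -> M}) (Z : set M) :
  bounded_map f -> closed Z -> closed (f @^-1` Z).
Proof.
move=> [k k0 kP] /closed_approxP cZ; apply/closed_approxP => x xZ.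
apply: cZ => e e0; have k1 : 0 < k + 1 by lra.
have [z Zz ze] := xZ _ (divr_gt0 e0 k1); exists (f z) => //.
rewrite -linearB (le_lt_trans (kP _))//.
move: ze; rewrite ltr_pdivlMr// => /(le_lt_trans _); apply.
by rewrite mulrC ler_wpM2l ?rnorm_ge0//; lra.
Qed.

Lemma rcvg_bounded {R : realType} {L M : normedModType R[i]}
    (f : {linear L -> M}) u l : bounded_map f -> rcvg u l -> rcvg (f \o u) (f l).
Proof.
move=> [k k0 kP] ul e e0; have k1 : 0 < k + 1 by lra.
have [n0 h] := ul _ (divr_gt0 e0 k1); exists n0 => n /h /=.
rewrite ltr_pdivlMr// => /(le_lt_trans _); apply.
rewrite -linearB (le_trans (kP _))// mulrC ler_wpM2l ?rnorm_ge0//; lra.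
Qed.

(** * Subspaces of finite codimension *)

Lemma ex_min_nat (P : nat -> Prop) n : P n ->
  exists m, P m /\ forall k, P k -> (m <= k)%N.
Proof.
move=> Pn; have ex : exists m, `[< P m >] by exists n; exact/asboolP.
case: (ex_minnP ex) => m /asboolP Pm h; exists m; split=> // k Pk.
exact/h/asboolP.
Qed.

(* Unlike [linearB] and [linearZ], instances of this rule rewrite only under  *)
(* the given f, not under scalings and opposites, which are also linear.      *)
Lemma linE (K : pzRingType) (U V : lmodType K) (f : {linear U -> V}) :
  ((forall x y : U, (f (x + y) = f x + f y)%R) * (forall x y : U, (f (x - y) = f x - f y)%R) *
  (forall x : U, f (- x)%R = (- f x)%R) * (forall k (x : U), f (k *: x) = k *: f x) * (f 0 = 0))%type.
Proof.
by do !split; [exact: linearD|exact: linearB|exact: linearN|exact: linearZ_LR|exact: linear0].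
Qed.

Section subspaces.
Context {R : realType} {L : banachLieType R}.
Implicit Types (S W Z : set L).

Section closure_properties.
Variables (W : set L) (sW : linear_subspace W).

Lemma subspace0 : W 0. Proof. by case: sW. Qed.

Lemma subspaceD x y : W x -> W y -> W (x + y).
Proof. by move=> Wx Wy; rewrite -[x]scale1r; apply: sW.2. Qed.

Lemma subspaceZ k x : W x -> W (k *: x).
Proof. by move=> Wx; rewrite -[_ *: _]addr0; apply: sW.2 => //; exact: subspace0. Qed.

Lemma subspaceN x : W x -> W (- x).
Proof. by move=> Wx; rewrite -scaleN1r; exact: subspaceZ. Qed.

Lemma subspaceB x y : W x -> W y -> W (x - y).
Proof. by move=> Wx Wy; apply/subspaceD => //; exact: subspaceN. Qed.

Lemma subspace_sum (I : Type) (r : seq I) (P : pred I) (F : I -> L) :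
  (forall i, P i -> W (F i)) -> W (\sum_(i <- r | P i) F i).
Proof.
by move=> WF; elim/big_ind: _ => //; [exact: subspace0|exact: subspaceD].
Qed.

Lemma subspace_sub x y : W (x - y) -> W x <-> W y.
Proof.
move=> Wxy; split=> [Wx|Wy]; last by rewrite -[x](subrK y); exact: subspaceD.
by rewrite -[y](subKr x); exact: subspaceB.
Qed.

Lemma subspaceZK k x : k != 0 -> W (k *: x) -> W x.
Proof. by move=> k0 /(subspaceZ k^-1); rewrite scalerA mulVf// scale1r. Qed.

End closure_properties.

Lemma subspace_setT : linear_subspace [set: L]. Proof. by []. Qed.

Lemma subspaceI W Z : linear_subspace W -> linear_subspace Z ->
  linear_subspace (W `&` Z).
Proof.
move=> sW sZ; split; first by split; exact: subspace0.
by move=> k x y [Wx Zx] [Wy Zy]; split; [exact: sW.2|exact: sZ.2].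
Qed.

Lemma subspace_preimage (M : banachLieType R) (f : {linear M -> L}) W :
  linear_subspace W -> linear_subspace (f @^-1` W).
Proof.
move=> sW; split; first by rewrite /preimage /= linear0; exact: subspace0.
by move=> k x y /=; rewrite linearP; exact: sW.2.
Qed.

Definition setadd W Z : set L := [set x | exists2 w, W w & Z (x - w)].

Lemma subspace_add W Z : linear_subspace W -> linear_subspace Z ->
  linear_subspace (setadd W Z).
Proof.
move=> sW sZ; split; first by exists 0; rewrite ?subrr; exact: subspace0.
move=> k x y [w Ww Zw] [v Wv Zv]; exists (k *: w + v); first exact: sW.2.
by rewrite opprD addrACA -scalerBr; exact: sZ.2.
Qed.

Lemma setaddl W Z : linear_subspace Z -> W `<=` setadd W Z.
Proof. by move=> sZ x Wx; exists x; rewrite ?subrr//; exact: subspace0. Qed.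

Lemma setaddr W Z : linear_subspace W -> Z `<=` setadd W Z.
Proof. by move=> sW x Zx; exists 0; rewrite ?subr0//; exact: subspace0. Qed.

Definition line (v : L) : set L := [set x | exists k, x = k *: v].

Lemma subspace_line v : linear_subspace (line v).
Proof.
split; first by exists 0; rewrite scale0r.
by move=> k _ _ [a ->] [b ->]; exists (k * a + b); rewrite scalerDl scalerA.
Qed.

Lemma line_self v : line v v. Proof. by exists 1; rewrite scale1r. Qed.

Definition spanned_by n W (e : 'I_n -> L) :=
  forall x, exists c : 'I_n -> R[i], W (x - \sum_i c i *: e i).

(** A relation modulo [Z] with [c j] nonzero expresses [e j] through the other vectors. *)
Lemma spanned_drop n W Z (e : 'I_n.+1 -> L) (c : 'I_n.+1 -> R[i]) j :
  linear_subspace Z -> W `<=` Z -> spanned_by W e ->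
  Z (\sum_i c i *: e i) -> c j != 0 -> spanned_by Z (e \o lift j).
Proof.
move=> sZ WZ We Zc cj x; have [d /WZ Zd] := We x.
exists (fun i => d (lift j i) - d j * (c j)^-1 * c (lift j i)) => /=.
rewrite (_ : x - _ = (x - \sum_i d i *: e i) +
   (d j * (c j)^-1) *: \sum_i c i *: e i).
  by apply: subspaceD => //; exact: subspaceZ.
rewrite !(bigD1_ord j)//= -addrA; congr (_ + _).
rewrite scalerDr !scalerA mulfVK// opprD addrAC addrA.
rewrite [- _ + d j *: _]addrC subrr add0r.
rewrite scaler_sumr -sumrB -sumrN.
by apply: eq_bigr => i _; rewrite scalerA scalerBl opprB.
Qed.

Definition codim_le n W := exists e : 'I_n -> L, spanned_by W e.

(** The expansion of [x] is a relation modulo [Z], and its coefficients are not all zero because [x]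
    is not in [W]. Inductions on codimension and the existence of maximal members rest on this. *)
Lemma codim_le_proper n W Z x : linear_subspace W -> linear_subspace Z ->
  W `<=` Z -> Z x -> ~ W x -> codim_le n W ->
  exists2 m, (m < n)%N & codim_le m Z.
Proof.
move=> sW sZ WZ Zx Wx [e We]; have [c Wc] := We x.
have [[j cj]|c0] := pselect (exists j, c j != 0); last first.
  case: Wx; suff -> : x = x - \sum_i c i *: e i by [].
  rewrite big1 ?subr0// => i _; have [->|ci] := eqVneq (c i) 0.
    by rewrite scale0r.
  by case: c0; exists i.
case: n e We c Wc j cj => [|n] e We c Wc j cj; first by case: j cj.
exists n => //; exists (e \o lift j); apply: spanned_drop We _ cj => //.
by apply/(subspace_sub sZ (WZ _ Wc)).
Qed.

Lemma finite_codimS W Z : W `<=` Z -> finite_codim W -> finite_codim Z.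
Proof. by move=> WZ [n [e h]]; exists n, e => x; have [c /WZ] := h x; exists c. Qed.

Lemma finite_codimT : finite_codim [set: L].
Proof. by exists 0%N, (fun=> 0) => x; exists (fun=> 0). Qed.

(** A spanning family of least length is free modulo [W], so the coefficients are unique and hence
    linear in the vector. *)
Lemma finite_codim_coords W : linear_subspace W -> finite_codim W ->
  exists n (e : 'I_n -> L) (c : {linear L -> 'rV[R[i]]_n}),
    [/\ forall x, W x <-> c x = 0,
        forall x, W (x - \sum_i c x 0 i *: e i)
      & forall r : 'rV[R[i]]_n, c (\sum_i r 0 i *: e i) = r].
Proof.
move=> sW [n0 [e0 h0]].
have [n [[e We] nmin]] := @ex_min_nat (fun n => codim_le n W) _ (ex_intro _ e0 h0).
have free (c : 'I_n -> R[i]) : W (\sum_i c i *: e i) -> forall i, c i = 0.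
  move=> Wc j; apply/eqP/negP => /negP cj.
  case: n e We nmin c Wc j cj => [|n] e We nmin c Wc j cj; first by case: j cj.
  have /nmin : codim_le n W by exists (e \o lift j); exact: spanned_drop We Wc cj.
  by rewrite ltnn.
have /choice[d dP] := We.
have duniq x (a : 'I_n -> R[i]) : W (x - \sum_i a i *: e i) -> a = d x.
  move=> Wa; apply/funext => i; apply/eqP; rewrite -subr_eq0; apply/eqP.
  apply: (free (fun i => a i - d x i)).
  rewrite (_ : \sum_i _ = (x - \sum_i d x i *: e i) - (x - \sum_i a i *: e i)).
    exact: subspaceB.
  rewrite opprB addrC addrA subrK -sumrB.
  by apply: eq_bigr => j _; rewrite scalerBl.
pose c x : 'rV[R[i]]_n := \row_i d x i.
have clin : linear c.
  move=> k x y; apply/rowP => i; rewrite !mxE.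
  rewrite -(duniq (k *: x + y) (fun i => k * d x i + d y i))//.
  rewrite (_ : _ - _ = k *: (x - \sum_i d x i *: e i) + (y - \sum_i d y i *: e i)).
    exact: sW.2.
  rewrite scalerBr addrACA -opprD scaler_sumr -big_split/=; congr (_ - _).
  by apply: eq_bigr => j _; rewrite scalerDl scalerA.
pose cl : {linear L -> 'rV[R[i]]_n} := HB.pack c (GRing.isLinear.Build _ _ _ _ c clin).
exists n, e, cl; split=> [x|x|r] /=.
- split=> [Wx|cx].
    apply/rowP => i; rewrite !mxE -(duniq x (fun=> 0))// big1 ?subr0// => j _.
    by rewrite scale0r.
  suff -> : x = x - \sum_i d x i *: e i by [].
  rewrite big1 ?subr0// => i _; have := congr1 (fun r : 'rV_n => r 0 i) cx.
  by rewrite !mxE => ->; rewrite scale0r.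
- rewrite (eq_bigr (fun i => d x i *: e i)) => [//|i _]; by rewrite mxE.
- apply/rowP => i; rewrite mxE -(duniq _ (fun i => r 0 i))//.
  by rewrite subrr; exact: subspace0.
Qed.

Lemma finite_codim_functional W (f : {linear L -> R[i]^o}) : linear_subspace W ->
  finite_codim W -> finite_codim (W `&` [set x | f x = 0]).
Proof.
move=> sW [n [e We]].
have [[v [Wv fv]]|h] := pselect (exists v, W v /\ f v != 0); last first.
  exists n, e => x; have [c Wc] := We x; exists c; split=> //=.
  by apply: contrapT => /eqP fc; apply: h; eexists; split; [exact: Wc|].
(* Index 0 carries the extra vector [v] of [W]; its coefficient [f y / f v] cancels the value of [f]
   on the remainder. *)
exists n.+1, (fun i => oapp e v (unlift ord0 i)) => x.
have [c Wc] := We x; set y := x - _ in Wc.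
exists (fun i => oapp c (f y / f v) (unlift ord0 i)).
rewrite big_ord_recl unlift_none /= (eq_bigr (fun i => c i *: e i)); last first.
  by move=> i _; rewrite liftK.
rewrite opprD addrCA addrC -/y; split; first by apply: subspaceB => //; exact: subspaceZ.
by rewrite linearB linearZ /= /GRing.scale /= mulfVK// subrr.
Qed.

Lemma finite_codim_kernel n W (f : {linear L -> 'rV[R[i]]_n}) : linear_subspace W ->
  finite_codim W -> finite_codim (W `&` [set x | f x = 0]).
Proof.
move=> sW fW.
pose Wk k := W `&` [set x | forall i : 'I_n, (i < k)%N -> f x 0 i = 0].
have sWk k : linear_subspace (Wk k).
  apply: subspaceI => //; split=> [i _|a x y fx fy i ik]; first by rewrite linear0 mxE.
  by rewrite linearP !mxE fx// fy// mulr0 addr0.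
suff : finite_codim (Wk n).
  apply: finite_codimS => x [Wx fx]; split=> //=; apply/rowP => i.
  by rewrite fx// mxE.
suff : forall k, (k <= n)%N -> finite_codim (Wk k) by exact.
elim=> [_|k IH kn]; first by apply: finite_codimS fW => x Wx; split.
pose phi x := f x 0 (Ordinal kn).
have philin : linear (phi : L -> R[i]^o) by move=> a x y; rewrite /phi linearP !mxE.
pose phil : {linear L -> R[i]^o} := HB.pack (phi : L -> R[i]^o) (GRing.isLinear.Build _ _ _ _ _ philin).
apply: finite_codimS (finite_codim_functional phil (sWk k) (IH (ltnW kn))).
move=> x [[Wx fx] /= px]; split=> //= i; rewrite ltnS leq_eqVlt => /predU1P[ik|]; last exact: fx.
by rewrite -px /phi; congr (f x 0 _); exact: val_inj.
Qed.

Lemma finite_codimI W Z : linear_subspace W -> linear_subspace Z ->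
  finite_codim W -> finite_codim Z -> finite_codim (W `&` Z).
Proof.
move=> sW sZ fW fZ; have [n [e [c [cW _ _]]]] := finite_codim_coords sZ fZ.
apply: finite_codimS (finite_codim_kernel c sW fW) => x [Wx cx].
by split=> //; exact/cW.
Qed.

End subspaces.

Lemma finite_codim_preimage (R : realType) (L M : banachLieType R) (f : {linear M -> L}) (W : set L) :
  linear_subspace W -> finite_codim W -> finite_codim (f @^-1` W).
Proof.
move=> sW fW; have [n [e [c [cW _ _]]]] := finite_codim_coords sW fW.
apply: finite_codimS (finite_codim_kernel (c \o f) (@subspace_setT _ _) (@finite_codimT _ _)).
by move=> x [_ /= cx]; exact/cW.
Qed.

(** * Closed subspaces of finite codimension *)

Section closed_subspaces.
Context {R : realType} {L : banachLieType R}.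
Implicit Types (W Z : set L).

Lemma closed_dist Z x : closed Z -> ~ Z x ->
  exists2 d : R, 0 < d & forall z, Z z -> d <= rnorm (x - z).
Proof.
move=> /closed_approxP cZ Zx; apply: contrapT => h; apply/Zx/cZ => e e0.
apply: contrapT => h2; apply: h; exists e => // z Zz.
by rewrite leNgt; apply/negP => ze; apply: h2; exists z.
Qed.

(** If [v] is at distance d > 0 from [Z], then |k| d is at most the norm of k v - z. So the
    coefficients along [v] of approximants of a point are Cauchy, and subtracting their limit leaves
    a point of [Z]. *)
Lemma closed_add_line Z v : linear_subspace Z -> closed Z -> closed (setadd Z (line v)).
Proof.
move=> sZ cZ; have [Zv|Zv] := pselect (Z v).
  suff -> : setadd Z (line v) = Z by [].
  apply/seteqP; split; last by apply: setaddl; exact: subspace_line.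
  move=> x [z Zz [k xz]]; rewrite -[x](subrK z) xz.
  by apply: subspaceD => //; exact: subspaceZ.
have [d d0 dP] := closed_dist cZ Zv.
have dk (k : R[i]) z : Z z -> cmod k * d <= rnorm (k *: v - z).
  move=> Zz; have [->|k0] := eqVneq k 0.
    by rewrite (eqP (_ : cmod 0 == 0)) ?cmod_eq0// mul0r rnorm_ge0.
  rewrite -[z](scale1r) -(divff k0) -scalerA -scalerBr rnormZ ler_wpM2l ?cmod_ge0//.
  by apply: dP; exact: subspaceZ.
apply/closed_approxP => x xZ.
have /choice[zc zcP] : forall n : nat, exists zc : L * R[i], Z zc.1 /\
    rnorm (x - (zc.2 *: v + zc.1)) < n.+1%:R^-1.
  move=> n; have [|y [z Zz [k yz]] xy] := xZ (n.+1%:R^-1); first by rewrite invr_gt0.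
  by exists (z, k); split => //=; rewrite -yz subrK.
pose c n := (zc n).2; pose z n := (zc n).1.
have cc n m : cmod (c n - c m) * d < n.+1%:R^-1 + m.+1%:R^-1.
  have Znm : Z (z m - z n) by apply: subspaceB => //; [exact: (zcP m).1|exact: (zcP n).1].
  apply: le_lt_trans (dk (c n - c m) _ Znm) _.
  rewrite (_ : _ - _ = (c n *: v + z n) - (c m *: v + z m)); last first.
    by rewrite scalerBl opprB addrACA -opprD.
  rewrite (le_lt_trans (rnorm_dist x _ _))// rnormB ltrD//; first exact: (zcP n).2.
  exact: (zcP m).2.
have [|l lP] := complex_complete (u := c).
  move=> e e0; have e2 : 0 < e * d / 2 by rewrite divr_gt0// mulr_gt0.
  have [n0 h] := harmonic_lt e2; exists n0 => n m /h h1 /h h2.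
  by rewrite -(ltr_pM2r d0) (lt_trans (cc n m))// [ltRHS]splitr ltrD.
exists (x - l *: v); last by exists l; rewrite subKr.
move/closed_approxP : cZ; apply => e e0.
have e2 : 0 < e / 2 by rewrite divr_gt0.
have v0 : 0 < rnorm v + 1 by have := rnorm_ge0 v; lra.
have [n0 h0] := harmonic_lt e2; have [n1 h1] := lP _ (divr_gt0 e2 v0).
set n := maxn n0 n1; exists (z n); first exact: (zcP n).1.
rewrite (_ : _ - _ = (x - (c n *: v + z n)) + (c n - l) *: v); last first.
  by rewrite (addrC (c n *: v)) opprD addrA scalerBl [RHS]addrA subrK addrAC.
apply: le_lt_trans (rnormD _ _) _; rewrite [ltRHS]splitr rnormZ ltrD//.
  by apply: lt_trans (zcP n).2 _; exact/h0/leq_maxl.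
have := h1 n (leq_maxr _ _); rewrite ltr_pdivlMr//; apply: le_lt_trans.
by rewrite ler_wpM2l ?cmod_ge0// lerDl.
Qed.

(** [Z] is enlarged one line at a time. This makes closedness automatic for subspaces that are
    constructed algebraically above [S]. *)
Lemma closed_superspace W Z : linear_subspace Z -> linear_subspace W ->
  closed Z -> finite_codim Z -> Z `<=` W -> closed W.
Proof.
move=> + sW + [n]; elim/ltn_ind: n Z => n IH Z sZ cZ fZ ZW.
have [WZ|/existsNP[x /not_implyP[Wx Zx]]] := pselect (W `<=` Z).
  by rewrite (_ : W = Z)//; apply/seteqP.
pose Z' := setadd Z (line x).
have sZ' : linear_subspace Z' by apply: subspace_add => //; exact: subspace_line.
have ZZ' : Z `<=` Z' by apply: setaddl; exact: subspace_line.
have Z'x : Z' x by apply: setaddr => //; exact: line_self.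
have [m mn fZ'] := codim_le_proper sZ sZ' ZZ' Z'x Zx fZ.
apply: (IH m mn Z') => //; first exact: closed_add_line.
move=> y [z /ZW Wz [k yz]]; rewrite -[y](subrK z) yz.
by apply: subspaceD => //; exact: subspaceZ.
Qed.

(** Modulo [Z], [x] equals mu^-n D^n x for every n. If |mu| > C this tends to 0, and [x] would lie
    in the closed subspace [Z]. *)
Lemma spectral_bound (D : {linear L -> L}) (C : R) Z x (mu : R[i]) :
  0 <= C -> (forall y, rnorm (D y) <= C * rnorm y) ->
  linear_subspace Z -> closed Z -> (forall y, Z y -> Z (D y)) ->
  Z (D x - mu *: x) -> ~ Z x -> cmod mu <= C.
Proof.
move=> C0 DC sZ cZ DZ Zx nZx; rewrite leNgt; apply/negP => Cmu.
have mu0 : 0 < cmod mu by exact: le_lt_trans Cmu.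
have mun0 : mu != 0 by rewrite -cmod_gt0.
apply: nZx; move/closed_approxP : cZ; apply => e e0.
pose r := C / cmod mu.
have r0 : 0 <= r by rewrite divr_ge0// ltW.
have r1 : r < 1 by rewrite ltr_pdivrMr// mul1r.
have [n hn] := geometric_lt (rnorm x) r0 r1 e0.
suff [z Zz ze] : exists2 z, Z z & rnorm (x - z) <= r ^+ n * rnorm x.
  by exists z => //; exact: le_lt_trans hn.
elim: n {hn} => [|n [z Zz IH]].
  by exists 0; rewrite ?subr0 ?expr0 ?mul1r//; exact: subspace0.
exists (mu^-1 *: (D z - (D x - mu *: x))).
  by apply: subspaceZ => //; apply: subspaceB => //; exact: DZ.
rewrite (_ : _ - _ = mu^-1 *: D (x - z)).
  rewrite rnormZ cmodV exprS [leRHS](_ : _ = (cmod mu)^-1 * (C * (r ^+ n * rnorm x))).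
    rewrite ler_wpM2l ?invr_ge0 ?cmod_ge0//.
    by rewrite (le_trans (DC _))// ler_wpM2l.
  by rewrite /r mulrCA !mulrA.
rewrite (linearB D) -{1}[x]scale1r -(mulVf mun0) -scalerA -scalerBr; congr (_ *: _).
by rewrite opprB addrA [mu *: x + _]addrC subrK.
Qed.

End closed_subspaces.

(** * Root spaces *)

Section eigenvectors.
Context {R : realType} {L : banachLieType R}.
Implicit Types (W Z U K : set L) (D : {linear L -> L}).

Definition stable_under D W := forall x, W x -> W (D x).

Definition shifted D (s : seq R[i]) x := foldr (fun mu y => D y - mu *: y) x s.

Lemma shifted_stable D W s x : linear_subspace W -> stable_under D W ->
  W x -> W (shifted D s x).
Proof.
move=> sW DW Wx; elim: s => //= mu s Wy.
by apply: subspaceB => //; [exact: DW|exact: subspaceZ].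
Qed.

Lemma shiftedC D mu nu y :
  D (D y - mu *: y) - nu *: (D y - mu *: y) =
  D (D y - nu *: y) - mu *: (D y - nu *: y).
Proof.
rewrite !(linE D) !scalerBr !scalerA (mulrC nu) !opprB.
by rewrite addrACA [RHS]addrACA; congr (_ + _); rewrite addrC.
Qed.

Lemma shifted_perm D s t x : perm_eq s t -> shifted D s x = shifted D t x.
Proof.
elim: s t => [|mu s IH] t st; first by rewrite perm_sym in st; rewrite (perm_nilP st).
have mut : mu \in t by rewrite -(perm_mem st) mem_head.
case/splitPr: mut st => t1 t2; rewrite perm_sym perm_catC/= perm_cons perm_catC perm_sym.
move=> /IH /= ->; rewrite /shifted !foldr_cat /=; set y := foldr _ x t2.
elim: t1 => //= nu t1 IH1; rewrite -IH1; exact: shiftedC.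
Qed.

(** Coordinates are rows, so composing operators multiplies their matrices in the reverse order. *)
Lemma quotient_matrix D W n (e : 'I_n -> L) (c : {linear L -> 'rV[R[i]]_n}) :
  stable_under D W -> (forall x, W x <-> c x = 0) ->
  (forall x, W (x - \sum_i c x 0 i *: e i)) ->
  exists A : 'M[R[i]]_n, forall x, c (D x) = c x *m A.
Proof.
move=> DW cW We; exists (\matrix_i c (D (e i))) => x.
have /DW/cW : W (x - \sum_i c x 0 i *: e i) by [].
rewrite !linearB /= => /eqP; rewrite subr_eq0 => /eqP ->.
rewrite mulmx_sum_row !linear_sum /=; apply: eq_bigr => i _.
by rewrite rowK !linearZ.
Qed.

(** Cayley-Hamilton on L / W: [s] lists the roots of the characteristic polynomial, which splits
    over [R[i]]. *)
Lemma annihilating_shifts D W : linear_subspace W -> finite_codim W ->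
  stable_under D W -> exists s, forall x, W (shifted D s x).
Proof.
move=> sW fW DW; have [n [e [c [cW We _]]]] := finite_codim_coords sW fW.
have [A cA] := quotient_matrix DW cW We.
case: n e c cW We A cA => [|n] e c cW We A cA.
  by exists [::] => x; apply/cW/rowP => -[].
have [s ps] := closed_field_poly_normal (char_poly A).
exists s => x; apply/cW.
suff -> : c (shifted D s x) = c x *m horner_mx A (\prod_(z <- s) ('X - z%:P)).
  rewrite -[X in horner_mx _ X]scale1r -(monicP (char_poly_monic A)) -ps.
  by rewrite Cayley_Hamilton mulmx0.
elim: s {ps} => [|mu s IH] /=; first by rewrite big_nil rmorph1 mulmx1.
rewrite big_cons mulrC rmorphM linearB linearZ /= cA IH -mulmxE mulmxA.
by rewrite rmorphB /= horner_mx_X horner_mx_C mulmxBr mul_mx_scalar.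
Qed.

(** The last vector before the successive shifts enter [K] is an eigenvector modulo [K]. *)
Lemma eigenvector_between D U K s x :
  linear_subspace U -> stable_under D U -> U x -> ~ K x -> K (shifted D s x) ->
  exists y mu, [/\ U y, ~ K y & K (D y - mu *: y)].
Proof.
move=> sU DU Ux Kx; elim: s => [//|mu s IH] /= Kmu.
have [/IH//|Ky] := pselect (K (shifted D s x)).
by exists (shifted D s x), mu; split=> //; exact: shifted_stable.
Qed.

(* An eigenvector of D on U modulo the kernel of T, with eigenvalue mu, is     *)
(* sent by T to an eigenvector with eigenvalue mu + c; both are at most C.     *)
Lemma intertwining_vanishes D (T : {linear L -> L}) (C : R) (c : R[i]) U Z :
  0 <= C -> (forall y, rnorm (D y) <= C * rnorm y) -> bounded_map T ->
  linear_subspace U -> closed U -> finite_codim U -> stable_under D U ->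
  linear_subspace Z -> closed Z -> finite_codim Z -> stable_under D Z ->
  (forall x, U x -> Z (D (T x) - T (D x) - c *: T x)) ->
  2 * C < cmod c -> forall x, U x -> Z (T x).
Proof.
move=> C0 DC bT sU cU fU DU sZ cZ fZ DZ TZ Cc x Ux; apply: contrapT => Zx.
pose K := U `&` (T @^-1` Z).
have sK : linear_subspace K by apply: subspaceI => //; exact: subspace_preimage.
have cK : closed K by apply: closedI => //; exact: closed_preimage_bounded.
have fK : finite_codim K.
  by apply: finite_codimI => //; [exact: subspace_preimage|exact: finite_codim_preimage].
have DK : stable_under D K.
  move=> y [Uy Zy]; split; first exact: DU.
  rewrite /preimage /= (_ : T (D y) = D (T y) - c *: T y - (D (T y) - T (D y) - c *: T y)).
    by apply: subspaceB (TZ y Uy) => //; apply: subspaceB; [|exact: DZ|exact: subspaceZ].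
  by rewrite [D (T y) - T (D y) - _]addrAC opprB [RHS]addrC subrK.
have [s sP] := annihilating_shifts sK fK DK.
have nKx : ~ K x by case.
have [y [mu [Uy Ky Kmu]]] := eigenvector_between sU DU Ux nKx (sP x).
have muC : cmod mu <= C by exact: (spectral_bound C0 DC sK cK DK Kmu).
have ZTy : ~ Z (T y) by move=> Zy; apply: Ky.
have : Z (D (T y) - (mu + c) *: T y).
  have := subspaceD sZ (TZ y Uy) Kmu.2; rewrite /preimage /= !(linE T).
  by rewrite addrAC addrA subrK -addrA -opprD -scalerDl.
move=> /(spectral_bound C0 DC sZ cZ DZ)/(_ ZTy) mucC.
have := cmodD (mu + c) (- mu); rewrite cmodN addrAC subrr add0r.
by move: muC mucC Cc; lra.
Qed.

Definition root_space D Z (lambda : R[i]) : set L :=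
  [set x | exists a, Z (shifted D (nseq a lambda) x)].

(** Take a product of factors D - mu annihilating L / Z and apply to [x] those with mu different
    from [lambda]. The result lies in the root space, hence in [W]; modulo [W] it is [x] times the
    nonzero product of the [lambda - mu]. *)
Lemma eigenvector_lift D Z W lambda x : linear_subspace Z -> finite_codim Z ->
  linear_subspace W -> stable_under D Z -> stable_under D W ->
  root_space D Z lambda `<=` W ->
  W (D x - lambda *: x) -> W x.
Proof.
move=> sZ fZ sW DZ DW rW Wx.
have [s sP] := annihilating_shifts sZ fZ DZ.
pose s1 := [seq mu <- s | mu != lambda].
have [k k0 Wk] : exists2 k, k != 0 & W (shifted D s1 x - k *: x).
  rewrite /s1; elim: s {sP s1} => [|mu s IH] /=.
    by exists 1; rewrite ?oner_neq0// scale1r subrr; exact: subspace0.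
  case: IH => k k0 Wk; case: ifPn => [ml|_]; last by exists k.
  exists (k * (lambda - mu)); first by rewrite mulf_neq0// subr_eq0 eq_sym.
  set y := shifted _ _ _ in Wk; rewrite -[shifted _ _ _]/(D y - mu *: y).
  rewrite (_ : _ - _ = (D (y - k *: x) - mu *: (y - k *: x)) +
      k *: (D x - lambda *: x)).
    apply: subspaceD => //; last exact: subspaceZ.
    by apply: subspaceB => //; [exact: DW|exact: subspaceZ].
  have -> : D (y - k *: x) - mu *: (y - k *: x) =
      D y - mu *: y - k *: (D x - mu *: x).
    by rewrite !(linE D) !scalerBr !scalerA (mulrC k) !opprD !opprK addrACA.
  rewrite -[RHS]addrA; congr (_ + _); rewrite [RHS]addrC -scalerBr -scalerA -scalerN.
  by congr (_ *: _); rewrite opprB [RHS]addrC addrA subrK -scalerBl -scaleNr opprB.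
apply: (subspaceZK sW k0); apply/(subspace_sub sW Wk); apply: rW.
exists (count_mem lambda s); rewrite /shifted -foldr_cat.
have -> : nseq (count_mem lambda s) lambda = [seq mu <- s | mu == lambda].
  by rewrite -size_filter; apply/esym/all_pred1P/filter_all.
rewrite -[foldr _ _ _]/(shifted D _ _) (@shifted_perm _ _ s)//.
by rewrite perm_filterC.
Qed.

End eigenvectors.

(** * Engel's theorem *)

Section engel.
Context {F : fieldType} {n : nat}.
Local Notation M := 'M[F]_n.+1.
Implicit Types (H G : set M).

Fixpoint annihilated H p : set 'cV[F]_n.+1 :=
  if p is q.+1 then [set u | forall h, H h -> annihilated H q (h *m u)] else [set 0].

Lemma annihilated0 H p : annihilated H p 0.
Proof. by elim: p => [//|p IH] h Hh /=; rewrite mulmx0. Qed.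

Lemma annihilatedP H p k u v : annihilated H p u -> annihilated H p v ->
  annihilated H p (k *: u + v).
Proof.
elim: p u v => [|p IH] u v /=; first by move=> -> ->; rewrite scaler0 addr0.
by move=> Hu Hv h Hh; rewrite mulmxDr -scalemxAr; apply: IH; [exact: Hu|exact: Hv].
Qed.

Lemma annihilatedD H p u v : annihilated H p u -> annihilated H p v ->
  annihilated H p (u + v).
Proof. by move=> Hu Hv; rewrite -[u]scale1r; exact: annihilatedP. Qed.

Lemma annihilatedZ H p k u : annihilated H p u -> annihilated H p (k *: u).
Proof. by move=> Hu; rewrite -[_ *: _]addr0; apply: annihilatedP => //; exact: annihilated0. Qed.

Lemma annihilatedB H p u v : annihilated H p u -> annihilated H p v ->
  annihilated H p (u - v).
Proof. by move=> Hu Hv; rewrite -scaleN1r addrC; exact: annihilatedP. Qed.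

Lemma annihilated_pred H p u h : H h -> annihilated H p u -> annihilated H p.-1 (h *m u).
Proof. by case: p => [|p] Hh /=; [move=> ->; rewrite mulmx0|exact]. Qed.

Lemma annihilated_normalizer H y p u :
  (forall h, H h -> H (h *m y - y *m h)) -> annihilated H p u -> annihilated H p (y *m u).
Proof.
move=> Hy; elim: p u => [|p IH] u /=; first by move=> ->; rewrite mulmx0.
move=> Hu h Hh.
have -> : h *m (y *m u) = (h *m y - y *m h) *m u + y *m (h *m u).
  by rewrite mulmxBl !mulmxA subrK.
by apply: annihilatedD; [exact/Hu/Hy|exact/IH/Hu].
Qed.

Lemma annihilatedS H p u : annihilated H p u -> annihilated H p.+1 u.
Proof.
elim: p u => [u -> h _|p IH u Hu h Hh]; first by rewrite mulmx0.
exact/IH/Hu.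
Qed.

Lemma annihilated_le H p q u : (p <= q)%N -> annihilated H p u -> annihilated H q u.
Proof.
by move=> /subnK <-; elim: (q - p)%N => // d IH /IH; rewrite addSn; exact: annihilatedS.
Qed.

Definition nilpotent_action H := exists N, forall u, annihilated H N u.

(** Suppose v is in level p.+1 and y^i v in level p. Then h v and y v both satisfy this with i - 1,
    the former because levels are stable under y. So [k] factors lower the level by one, and [N * k]
    factors kill everything. *)
Lemma nilpotent_action_extend (H : {vspace M}) y k :
  (forall h, h \in H -> h *m y - y *m h \in H) -> y ^+ k = 0 ->
  nilpotent_action [set` H] -> nilpotent_action [set` (H + <[y]>)%VS].
Proof.
move=> Hy yk [N HN]; exists (N * k)%N => u.
pose A := annihilated [set` H]; pose B := annihilated [set` (H + <[y]>)%VS].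
suff : forall p u, A p u -> B (p * k)%N u by move/(_ N u); apply; exact: HN.
elim=> [//|p IH] {}u Au; rewrite mulSn.
suff : forall i v, (i <= k)%N ->
    A p.+1 v -> A p (y ^+ i *m v) -> B (i + p * k)%N v.
  by apply => //; rewrite yk mul0mx; exact: annihilated0.
elim=> [v _ Av|i IHi v ik Av Ayv] /=; first by rewrite expr0 mul1mx; exact: IH.
rewrite addSn => _ /memv_addP[h hH [_ /vlineP[c ->] ->]].
have Ahv : A p (h *m v) by exact: Av.
rewrite mulmxDl -scalemxAl; apply: annihilatedD; last first.
  apply: annihilatedZ; apply: IHi; rewrite ?(ltnW ik)//.
    by apply: annihilated_normalizer Av => x; exact: Hy.
  by rewrite mulmxA mulmxE -exprSr.
apply: IHi; rewrite ?(ltnW ik)//.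
  exact: annihilatedS.
elim: i {ik Ayv} => [|i IHi]; first by rewrite expr0 mul1mx.
rewrite exprS -mulmxE -mulmxA; apply: annihilated_normalizer IHi => x; exact: Hy.
Qed.

(* Each commutator with H lowers by one the degree by which x shifts the      *)
(* filtration by the spaces [annihilated H p].                                *)
Lemma normalizing_element (H : {vspace M}) G x :
  nilpotent_action [set` H] -> [set` H] `<=` G ->
  (forall a b, G a -> G b -> G (a *m b - b *m a)) -> G x -> x \notin H ->
  exists y, [/\ G y, y \notin H & forall h, h \in H -> h *m y - y *m h \in H].
Proof.
move=> [N HN] HG Gc.
pose A := annihilated [set` H].
(* The offset [N] keeps the degree shift a natural number: j = N + N imposes no condition, while j =
   0 sends level [N], which is the whole space, to level 0, forcing x = 0. *)
pose T j x := forall i u, A i u -> A (i + j - N)%N (x *m u).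
suff : forall j x, T j x -> G x -> x \notin H ->
    exists y, [/\ G y, y \notin H & forall h, h \in H -> h *m y - y *m h \in H].
  move/(_ (N + N)%N x); apply => i u _.
  by apply: annihilated_le (HN _); rewrite addnA addnK leq_addl.
elim=> [|j IH] {}x Tx Gx Hx.
  case/negP: Hx; suff -> : x = 0 by exact: mem0v.
  apply/matrixP => i j; have := Tx N (delta_mx j 0) (HN _).
  rewrite addn0 subnn /= => /matrixP/(_ i 0); rewrite !mxE => <-.
  rewrite (bigD1 j)//= big1 ?addr0 ?mxE ?eqxx ?mulr1// => l lj.
  by rewrite mxE (negPf lj) mulr0.
have [h|/existsNP[h /not_implyP[hH /negP hx]]] :=
  pselect (forall h, h \in H -> h *m x - x *m h \in H); first by exists x.
apply: (IH (h *m x - x *m h)) => //; last by apply: Gc => //; exact: HG.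
move=> i u Au; rewrite mulmxBl -!mulmxA; apply: annihilatedB.
  have := Tx i u Au; rewrite addnS; set v := x *m u => Av.
  by apply: annihilated_le (annihilated_pred (hH : [set` H] h) Av); lia.
case: i Au => [|i] Au.
  by rewrite (Au : u = 0) !mulmx0; exact: annihilated0.
by have := Tx i _ (Au h hH); apply: annihilated_le; lia.
Qed.

(** A largest subalgebra [H] of [G] acting nilpotently is all of [G], since otherwise a normalizing
    element of [G], itself nilpotent, could be adjoined. A nonzero vector of the lowest possible
    level is then killed by [G]. *)
Theorem engel G : G 0 -> (forall k a b, G a -> G b -> G (k *: a + b)) ->
  (forall a b, G a -> G b -> G (a *m b - b *m a)) ->
  (forall a, G a -> exists k, a ^+ k = 0) ->
  exists2 u : 'cV[F]_n.+1, u != 0 & forall a, G a -> a *m u = 0.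
Proof.
move=> G0 GD Gc Gn.
pose P d := exists H : {vspace M}, [/\ (\dim {:M} - \dim H)%N = d, [set` H] `<=` G,
  forall a b, a \in H -> b \in H -> a *m b - b *m a \in H & nilpotent_action [set` H]].
have P0 : P (\dim {:M} - \dim (0%VS : {vspace M}))%N.
  exists 0%VS; split=> //.
  - by move=> x /=; rewrite memv0 => /eqP ->.
  - by move=> a b; rewrite !memv0 => /eqP -> /eqP ->; rewrite mulmx0 subrr.
  - by exists 1%N => u h /=; rewrite memv0 => /eqP ->; rewrite mul0mx.
have [_ [[H [<- HG Hc [N HN]]] Hmax]] := ex_min_nat P0.
have GH x : G x -> x \in H.
  move=> Gx; apply/negPn/negP => Hx.
  have [y [Gy Hy yH]] := normalizing_element (ex_intro _ N HN) HG Gc Gx Hx.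
  have [k yk] := Gn y Gy.
  have sub : (\dim H < \dim (H + <[y]>))%N.
    rewrite (ltn_leqif (dimv_leqif_sup (addvSl _ _))); apply: contra Hy => /subvP; apply.
    exact/(subvP (addvSr _ _))/memv_line.
  have /Hmax : P (\dim {:M} - \dim (H + <[y]>))%N.
    exists (H + <[y]>)%VS; split=> //.
    - move=> _ /memv_addP[h hH [_ /vlineP[c ->] ->]]; rewrite addrC; apply: GD => //.
      exact: HG.
    - move=> _ _ /memv_addP[h hH [_ /vlineP[c ->] ->]] /memv_addP[h' h'H [_ /vlineP[c' ->] ->]].
      apply: (subvP (addvSl _ _)).
      rewrite (_ : _ - _ = (h *m h' - h' *m h) + c' *: (h *m y - y *m h) - c *: (h' *m y - y *m h')).
        by apply: rpredB; [apply: rpredD; [exact: Hc|exact/rpredZ/yH]|exact/rpredZ/yH].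
      rewrite !mulmxDl !mulmxDr -!scalemxAl -!scalemxAr !scalerBr !scalerA.
      move: (h *m h') (h *m y) (y *m h') (y *m y) (h' *m h) (h' *m y) (y *m h).
      by move=> m1 m2 m3 m4 m5 m6 m7; apply/matrixP => i j; rewrite !mxE; ring.
    - exact: nilpotent_action_extend yk (ex_intro _ N HN).
  have := dimvS (subvf (H + <[y]>)); lia.
have one_neq0 : (const_mx 1 : 'cV[F]_n.+1) != 0.
  apply/negP => /eqP/matrixP/(_ 0 0); rewrite !mxE => /eqP.
  by rewrite oner_eq0.
pose Q p := exists u, annihilated [set` H] p u /\ u != 0.
have [p [[u [Hu u0]] pmin]] := @ex_min_nat Q N (ex_intro _ _ (conj (HN _) one_neq0)).
exists u => // a /GH aH; apply/eqP/negPn/negP => au.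
case: p Hu pmin => [|p] Hu pmin; first by rewrite (Hu : u = 0) eqxx in u0.
have /pmin : Q p by exists (a *m u); split=> //; exact: Hu.
by rewrite ltnn.
Qed.

End engel.

(** * The exponential of a bounded derivation *)

HB.instance Definition _ (R : realType) (L : banachLieType R) (a : L) :=
  GRing.isLinear.Build R[i] L L _ (lie a) (lie_linearr a).

Section lie_bracket.
Context {R : realType} {L : banachLieType R}.
Implicit Types a b c : L.

Lemma lieDl a b c : lie (a + b) c = lie a c + lie b c.
Proof. by rewrite -[a]scale1r (lie_linearl c) !scale1r. Qed.

Lemma lie0l c : lie 0 c = 0.
Proof. by apply: (addrI (lie 0 c)); rewrite -lieDl !addr0. Qed.

Lemma lieZl k a c : lie (k *: a) c = k *: lie a c.
Proof. by rewrite -[k *: a]addr0 (lie_linearl c) lie0l addr0. Qed.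

Lemma lieNl a c : lie (- a) c = - lie a c.
Proof. by rewrite -scaleN1r lieZl scaleN1r. Qed.

Lemma lieBl a b c : lie (a - b) c = lie a c - lie b c.
Proof. by rewrite lieDl lieNl. Qed.

Lemma lieDr a b c : lie a (b + c) = lie a b + lie a c. Proof. exact: linearD. Qed.
Lemma lieBr a b c : lie a (b - c) = lie a b - lie a c. Proof. exact: linearB. Qed.
Lemma lieNr a b : lie a (- b) = - lie a b. Proof. exact: linearN. Qed.
Lemma lieZr k a b : lie a (k *: b) = k *: lie a b. Proof. exact: linearZ_LR. Qed.
Lemma lie0r a : lie a 0 = 0. Proof. exact: linear0. Qed.

Lemma lie_sumr (I : Type) (r : seq I) (P : pred I) (F : I -> L) a :
  lie a (\sum_(i <- r | P i) F i) = \sum_(i <- r | P i) lie a (F i).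
Proof. exact: linear_sum. Qed.

Lemma lie_suml (I : Type) (r : seq I) (P : pred I) (F : I -> L) c :
  lie (\sum_(i <- r | P i) F i) c = \sum_(i <- r | P i) lie (F i) c.
Proof. by elim/big_rec2: _ => [|i y x _ <-]; rewrite ?lie0l// lieDl. Qed.

Lemma lieC a b : lie a b = - lie b a.
Proof.
apply/eqP; rewrite -addr_eq0; apply/eqP; have := liexx (a + b).
by rewrite lieDl !lieDr !liexx add0r addr0 addrC.
Qed.

Lemma lie_derivation a b c : lie a (lie b c) = lie (lie a b) c + lie b (lie a c).
Proof.
have := lie_jacobi a b c; rewrite (lieC c (lie a b)) (lieC c a) lieNr.
by move=> /eqP; rewrite subr_eq0 => /eqP <-; rewrite subrK.
Qed.

Lemma lie_rbounded : exists2 t : R, 0 < t &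
  forall a b, rnorm (lie a b) <= t * rnorm a * rnorm b.
Proof.
have [t t0 tP] := @lie_bounded R L; exists t => // a b.
by rewrite -lecR !rmorphM /= -!normE; exact: tP.
Qed.

Lemma lie_bound a : exists2 k : R, 0 <= k & forall b, rnorm (lie a b) <= k * rnorm b.
Proof.
have [t t0 tP] := lie_rbounded; exists (t * rnorm a); last exact: tP.
by rewrite mulr_ge0 ?rnorm_ge0// ltW.
Qed.

Lemma rcvg_lie u v a b : rcvg u a -> rcvg v b -> rcvg (fun n => lie (u n) (v n)) (lie a b).
Proof.
move=> ua vb.
have hab : rcvg (fun n => lie a (v n)) (lie a b) by apply: rcvg_bounded vb; exact: lie_bound.
have hba : rcvg (fun n => lie (u n) b) (lie a b).
  rewrite lieC (_ : (fun n => _) = (fun n => - lie b (u n))).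
    by apply: rcvgN; apply: (rcvg_bounded (lie_bound b) ua).
  by apply/funext => n; rewrite lieC.
have h0 : rcvg (fun n => lie (u n - a) (v n - b)) 0.
  have [t t0 tP] := lie_rbounded => e e0.
  have [n0 h0] := ua _ (divr_gt0 e0 t0); have [n1 h1] := vb _ ltr01.
  exists (maxn n0 n1) => n; rewrite geq_max subr0 => /andP[/h0 + /h1].
  rewrite ltr_pdivlMr// mulrC => h2 h3; apply: le_lt_trans (tP _ _) _; apply: le_lt_trans h2.
  by rewrite ler_piMr ?(ltW h3)// mulr_ge0 ?rnorm_ge0// ltW.
have := rcvgB (rcvgD h0 (rcvgD hab hba)) (rcvg_cst (lie a b)).
rewrite add0r addrK; congr rcvg; apply/funext => n.
by rewrite lieBl !lieBr opprB [X in X + _ - _]addrACA -(opprD (lie (u n) b)) (addrC (lie a (v n))) subrK addrK.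
Qed.

End lie_bracket.

Lemma exp_coeff_binomial (F : numFieldType) (x y : F) n :
  \sum_(i < n.+1) (x ^+ i / i`!%:R) * (y ^+ (n - i) / (n - i)`!%:R) = (x + y) ^+ n / n`!%:R.
Proof.
rewrite addrC exprDn mulr_suml; apply: eq_bigr => i _.
have fn0 k : k`!%:R != 0 :> F by rewrite pnatr_eq0 -lt0n fact_gt0.
have <- : ('C(n, i) * (i`! * (n - i)`!))%:R = n`!%:R :> F by rewrite bin_fact// -ltnS.
rewrite !natrM -[X in _ = X / _]mulr_natr; field.
by rewrite !fn0/= pnatr_eq0 -lt0n bin_gt0 -ltnS.
Qed.

(** * Double sums and Cauchy products of exponential series *)

Section double_sums.

Lemma triangular_sum (V : nmodType) (f : nat -> nat -> V) n :
  \sum_(0 <= i < n) \sum_(0 <= j < n - i) f i j =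
  \sum_(0 <= k < n) \sum_(i < k.+1) f i (k - i)%N.
Proof.
elim: n => [|n IH]; first by rewrite !big_geq.
rewrite [RHS]big_nat_recr//= -IH big_nat_recr//= subSnn big_nat1.
rewrite (eq_big_nat _ _ (F2 := fun i => (\sum_(0 <= j < n - i) f i j) + f i (n - i)%N)).
  rewrite big_split/= -addrA; congr (_ + _).
  by rewrite big_ord_recr/= subnn big_mkord.
by move=> i /andP[_ ni]; rewrite subSn 1?ltnW// big_nat_recr.
Qed.

(** The Cauchy product misses from the n by n square exactly the corner i + j >= n. *)
Lemma square_sum (V : zmodType) (f : nat -> nat -> V) n :
  \sum_(0 <= i < n) \sum_(0 <= j < n) f i j - \sum_(0 <= k < n) \sum_(i < k.+1) f i (k - i)%N =
  \sum_(0 <= i < n) \sum_(n - i <= j < n) f i j.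
Proof.
rewrite -triangular_sum -sumrB; apply: eq_big_nat => i _.
by rewrite (big_cat_nat _ (n := (n - i)%N)) ?leq_subr//= addrAC subrr add0r.
Qed.

Context {R : realType}.
Local Open Scope ring_scope.

Definition exp_partial (C : R) n := \sum_(0 <= k < n) exp_coeff C k.

Lemma exp_partial_cvg C : exp_partial C @ \oo --> expR C.
Proof. exact: is_cvg_series_exp_coeff. Qed.

Lemma exp_partial_le C n : 0 <= C -> exp_partial C n <= expR C.
Proof.
move=> C0; apply: nondecreasing_cvgn_le; last exact: is_cvg_series_exp_coeff.
by apply: nondecreasing_series => k _ _; exact: exp_coeff_ge0.
Qed.

(** For the real exponential series the corner tends to [expR C * expR C - expR (C + C)], which is
    0. *)
Lemma square_remainder_lt C (K e : R) : 0 <= C -> 0 < e -> exists n0, forall n, (n0 <= n)%N ->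
  K * (\sum_(0 <= i < n) \sum_(n - i <= j < n) exp_coeff C i * exp_coeff C j) < e.
Proof.
move=> C0 e0.
have : (fun n => K * (exp_partial C n * exp_partial C n - exp_partial (C + C) n)) @ \oo -->
    K * (expR C * expR C - expR (C + C)).
  apply: cvgM; first exact: cvg_cst.
  by apply: cvgB; [apply: cvgM|]; exact: exp_partial_cvg.
rewrite expRD subrr mulr0 => /cvgrPdist_lt/(_ _ e0)[n0 _ h].
exists n0 => n /h /=; rewrite sub0r normrN => /ltr_normlW.
congr (_ * _ < _); rewrite -square_sum; congr (_ - _).
  rewrite /exp_partial mulr_suml; apply: eq_bigr => i _.
  by rewrite mulr_sumr.
by apply: eq_bigr => k _; rewrite /exp_coeff /= exp_coeff_binomial.
Qed.

(** Serves both for composing two exponentials and for bracketing them. *)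
Lemma square_sum_cvg0 (V : normedModType R[i]) (t : nat -> nat -> V) (C K : R) :
  0 <= C -> (forall i j, rnorm (t i j) <= K * (exp_coeff C i * exp_coeff C j)) ->
  rcvg (fun n => \sum_(0 <= i < n) \sum_(0 <= j < n) t i j -
                 \sum_(0 <= k < n) \sum_(i < k.+1) t i (k - i)%N) 0.
Proof.
move=> C0 tK; apply: rcvg_le (fun e => square_remainder_lt K C0) => n.
rewrite subr0 square_sum (le_trans (rnorm_sum _ _ _))// mulr_sumr ler_sum// => i _.
by rewrite (le_trans (rnorm_sum _ _ _))// mulr_sumr ler_sum.
Qed.

End double_sums.

Section exponential.
Context {R : realType} {L : banachLieType R} (D : {linear L -> L}) (C : R).
Hypotheses (C0 : 0 <= C) (DC : forall x, rnorm (D x) <= C * rnorm x).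
Implicit Types (t : R[i]) (x y : L) (Z : set L).

Definition exp_term t n x : L := (t ^+ n / n`!%:R) *: iter n D x.

Definition exp_sum t n x := \sum_(0 <= k < n) exp_term t k x.

Lemma iter_linear n : linear (iter n D).
Proof. by elim: n => [//|n IH] k x y /=; rewrite IH linearP. Qed.

Lemma exp_term_linear t n : linear (exp_term t n).
Proof.
move=> k x y; rewrite /exp_term iter_linear scalerDr !scalerA.
by rewrite (mulrC _ k).
Qed.

HB.instance Definition _ t n := GRing.isLinear.Build _ _ _ _ _ (exp_term_linear t n).

Lemma exp_sum_linear t n : linear (exp_sum t n).
Proof.
move=> k x y; rewrite /exp_sum scaler_sumr -big_split/=.
by apply: eq_bigr => i _; rewrite linearP.
Qed.

HB.instance Definition _ t n := GRing.isLinear.Build _ _ _ _ _ (exp_sum_linear t n).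

Lemma rnorm_iter n x : rnorm (iter n D x) <= C ^+ n * rnorm x.
Proof.
elim: n => [|n IH] /=; first by rewrite expr0 mul1r.
by rewrite (le_trans (DC _))// exprS -mulrA ler_wpM2l.
Qed.

Lemma rnorm_exp_term t n x : rnorm (exp_term t n x) <= exp_coeff (cmod t * C) n * rnorm x.
Proof.
rewrite /exp_term rnormZ cmodM cmodV cmodX cmod_nat /exp_coeff /= exprMn.
rewrite [leRHS](_ : _ = cmod t ^+ n / n`!%:R * (C ^+ n * rnorm x)); last first.
  by rewrite !mulrA; congr (_ * _); rewrite mulrAC.
by rewrite ler_wpM2l ?rnorm_iter// divr_ge0 ?exprn_ge0 ?cmod_ge0.
Qed.

Let tC0 t : 0 <= cmod t * C. Proof. by rewrite mulr_ge0 ?cmod_ge0. Qed.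

Lemma rnorm_exp_sumB t n m x : (n <= m)%N ->
  rnorm (exp_sum t m x - exp_sum t n x) <=
    (exp_partial (cmod t * C) m - exp_partial (cmod t * C) n) * rnorm x.
Proof.
move=> nm; rewrite /exp_sum /exp_partial !(big_cat_nat (leq0n n) nm) /=.
rewrite [X in rnorm X]addrC addKr [X in X * _]addrC addKr mulr_suml.
by rewrite (le_trans (rnorm_sum _ _ _))// ler_sum// => i _; exact: rnorm_exp_term.
Qed.

Lemma rnorm_exp_sum t n x : rnorm (exp_sum t n x) <= expR (cmod t * C) * rnorm x.
Proof.
have := @rnorm_exp_sumB t 0 n x (leq0n n).
rewrite [exp_sum t 0 x]big_geq// [exp_partial _ 0]big_geq// !subr0 => /le_trans; apply.
by rewrite ler_wpM2r ?rnorm_ge0// exp_partial_le.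
Qed.

Lemma exp_sum_cvg t x : exists l, rcvg (fun n => exp_sum t n x) l.
Proof.
apply: rcvg_complete => e e0.
have x0 : 0 < rnorm x + 1 by have := rnorm_ge0 x; lra.
have e1 : 0 < e / (rnorm x + 1) by rewrite divr_gt0.
have /cvgrPdist_lt/(_ _ e1)[n0 _ h] := @exp_partial_cvg R (cmod t * C).
have hn n m : (n0 <= n)%N -> (n <= m)%N -> rnorm (exp_sum t m x - exp_sum t n x) < e.
  move=> /h /= hn nm; apply: le_lt_trans (rnorm_exp_sumB _ _ nm) _.
  move: hn; rewrite ltr_pdivlMr// => /(le_lt_trans _); apply.
  rewrite ler_pM ?rnorm_ge0// ?lerDl//.
    by rewrite subr_ge0 /exp_partial (big_cat_nat (leq0n n) nm) /= lerDl sumr_ge0// => i _; exact: exp_coeff_ge0.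
  by rewrite (le_trans _ (ler_norm _))// lerB// exp_partial_le.
exists n0 => n m nn nm; have [nlem|/ltnW mlen] := leqP n m; last exact: hn.
by rewrite rnormB; exact: hn.
Qed.

Definition exp_map t x : L := sval (cid (exp_sum_cvg t x)).

Lemma exp_mapP t x : rcvg (fun n => exp_sum t n x) (exp_map t x).
Proof. exact: svalP (cid (exp_sum_cvg t x)). Qed.

Lemma exp_map_linear t : linear (exp_map t).
Proof.
move=> k x y; apply: rcvg_unique (exp_mapP _ _) _.
rewrite (_ : (fun n => _) = (fun n => k *: exp_sum t n x + exp_sum t n y)).
  by apply: rcvgD; [apply: rcvgZ|]; exact: exp_mapP.
by apply/funext => n; rewrite linearP.
Qed.

HB.instance Definition _ t := GRing.isLinear.Build _ _ _ _ _ (exp_map_linear t).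

Lemma rnorm_exp_map t x : rnorm (exp_map t x) <= expR (cmod t * C) * rnorm x.
Proof. by apply: rcvg_bound (exp_mapP t x) _ => n; exact: rnorm_exp_sum. Qed.

Lemma exp_map_bounded t : bounded_map (exp_map t).
Proof. by exists (expR (cmod t * C)); [exact: expR_ge0|exact: rnorm_exp_map]. Qed.

Lemma exp_map_stable t Z : linear_subspace Z -> closed Z -> stable_under D Z ->
  stable_under (exp_map t) Z.
Proof.
move=> sZ cZ DZ x Zx; apply: rcvg_closed cZ _ (exp_mapP t x) => n.
apply: subspace_sum => // k _; apply: subspaceZ => //.
by elim: k => //= k; exact: DZ.
Qed.

Lemma exp_term_comp t u i j x : exp_term t i (exp_term u j x) =
  ((t ^+ i / i`!%:R) * (u ^+ j / j`!%:R)) *: iter (i + j) D x.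
Proof.
rewrite iterD -scalerA; congr (_ *: _).
pose f : {linear L -> L} := HB.pack (iter i D) (GRing.isLinear.Build _ _ _ _ _ (iter_linear i)).
exact: (linearZ_LR f).
Qed.

Lemma exp_sum_comp t u x n :
  \sum_(0 <= k < n) \sum_(i < k.+1) exp_term t i (exp_term u (k - i) x) =
  exp_sum (t + u) n x.
Proof.
apply: eq_bigr => k _; rewrite /exp_term -exp_coeff_binomial scaler_suml.
by apply: eq_bigr => i _; rewrite [LHS]exp_term_comp subnKC// -ltnS.
Qed.

Lemma exp_mapD t u x : exp_map t (exp_map u x) = exp_map (t + u) x.
Proof.
have bnd i j : rnorm (exp_term t i (exp_term u j x)) <=
    rnorm x * (exp_coeff ((cmod t + cmod u) * C) i * exp_coeff ((cmod t + cmod u) * C) j).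
  have mono s k : cmod s <= cmod t + cmod u ->
      exp_coeff (cmod s * C) k <= exp_coeff ((cmod t + cmod u) * C) k.
    move=> su; rewrite /exp_coeff /= ler_wpM2r ?invr_ge0// lerXn2r ?nnegrE// ?ler_wpM2r//.
    by rewrite mulr_ge0// addr_ge0 ?cmod_ge0.
  rewrite (le_trans (rnorm_exp_term _ _ _))// mulrCA ler_pM ?exp_coeff_ge0 ?rnorm_ge0//.
    by rewrite mono// lerDl cmod_ge0.
  rewrite (le_trans (rnorm_exp_term _ _ _))// mulrC ler_wpM2l ?rnorm_ge0//.
  by rewrite mono// lerDr cmod_ge0.
have C1 : 0 <= (cmod t + cmod u) * C by rewrite mulr_ge0// addr_ge0 ?cmod_ge0.
have := square_sum_cvg0 C1 bnd; set F := (fun n => _) => F0.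
have h : rcvg (fun n => exp_sum t n (exp_sum u n x)) (exp_map (t + u) x).
  have := rcvgD F0 (exp_mapP (t + u) x); rewrite add0r; congr rcvg.
  apply/funext => n; rewrite /F exp_sum_comp subrK; apply: eq_bigr => i _.
  by rewrite [in RHS]/exp_sum linear_sum.
apply: rcvg_unique h.
have h1 := exp_mapP t (exp_map u x).
(* The bound on [exp_sum t n] is uniform in n, so the inner partial sum may be replaced by its
   limit. *)
have h2 : rcvg (fun n => exp_sum t n (exp_sum u n x - exp_map u x)) 0.
  have k0 := expR_gt0 (cmod t * C) => e e0.
  have [n0 h0] := exp_mapP u x (divr_gt0 e0 k0); exists n0 => n /h0.
  rewrite ltr_pdivlMr// subr0 mulrC; exact/le_lt_trans/rnorm_exp_sum.
have := rcvgD h2 h1; rewrite add0r; congr rcvg; apply/funext => n.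
by rewrite linearB subrK.
Qed.

Lemma exp_map0 x : exp_map 0 x = x.
Proof.
apply: rcvg_unique (exp_mapP 0 x) _ => e e0; exists 1%N => -[//|n] _.
rewrite /exp_sum big_nat_recl//= big1 => [|k _].
  by rewrite /exp_term /= expr0 fact0 divr1 scale1r addr0 subrr rnorm0.
by rewrite /exp_term exprS !mul0r scale0r.
Qed.

Lemma exp_mapK t x : exp_map (- t) (exp_map t x) = x.
Proof. by rewrite exp_mapD addNr exp_map0. Qed.

(** Second-order remainder: for |t| <= 1 every later term carries a factor at most |t|^2, and the
    remaining coefficients sum to at most [expR C]. *)
Lemma exp_map_derivative t x : cmod t <= 1 ->
  rnorm (exp_map t x - x - t *: D x) <= cmod t * (cmod t * (expR C * rnorm x)).
Proof.
move=> t1; have t0 := cmod_ge0 t.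
have h := rcvgB (rcvgB (exp_mapP t x) (rcvg_cst x)) (rcvg_cst (t *: D x)).
suff bnd n : rnorm (exp_sum t n.+2 x - x - t *: D x) <= cmod t * (cmod t * (expR C * rnorm x)).
  have h' : rcvg (fun n => exp_sum t n.+2 x - x - t *: D x) (exp_map t x - x - t *: D x).
    by move=> e /h[n0 hn0]; exists n0 => n nn; apply: hn0; lia.
  exact: rcvg_bound h' bnd.
have -> : exp_sum t n.+2 x - x - t *: D x = \sum_(0 <= k < n) exp_term t k.+2 x.
  rewrite /exp_sum !big_nat_recl//= /exp_term /= expr0 expr1 fact0 (_ : 1`! = 1%N)// !divr1 scale1r.
  by rewrite -[LHS]addrA -opprD (addrA x) [LHS]addrC addKr.
apply: le_trans (rnorm_sum _ _ _) _.
have le_exp : \sum_(0 <= k < n) exp_coeff C k.+2 <= expR C.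
  apply: le_trans (exp_partial_le n.+2 C0); rewrite /exp_partial !big_nat_recl//=.
  by rewrite addrA lerDr addr_ge0// exp_coeff_ge0.
rewrite !mulrA -mulrA (le_trans _ (ler_wpM2l _ (ler_wpM2r _ le_exp)))//; last 2 first.
  by rewrite mulr_ge0.
  exact: rnorm_ge0.
rewrite mulr_suml mulr_sumr ler_sum// => k _.
rewrite (le_trans (rnorm_exp_term _ _ _))// mulrA ler_wpM2r ?rnorm_ge0//.
rewrite /exp_coeff /= mulrA ler_wpM2r ?invr_ge0// exprMn ler_wpM2r ?exprn_ge0//.
rewrite !exprS mulrA ler_piMr ?mulr_ge0// exprn_ile1//.
Qed.

Hypothesis D_derivation : forall x y, D (lie x y) = lie (D x) y + lie x (D y).

Lemma exp_term_succ t n x : n.+1%:R *: exp_term t n.+1 x = t *: D (exp_term t n x).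
Proof.
rewrite /exp_term /= (linearZ_LR D) !scalerA; congr (_ *: _).
rewrite factS natrM exprS; field.
by rewrite nat1r !pnatr_eq0 -lt0n fact_gt0.
Qed.

(** Leibniz rule for divided powers. After multiplication by [n.+1], this factor is split as i +
    (n.+1 - i) in each summand. *)
Lemma exp_term_lie t n x y :
  exp_term t n (lie x y) = \sum_(i < n.+1) lie (exp_term t i x) (exp_term t (n - i) y).
Proof.
elim: n => [|n IH].
  by rewrite big_ord1 /exp_term /= expr0 fact0 divr1 !scale1r.
have n0 : n.+1%:R != 0 :> R[i] by rewrite pnatr_eq0.
apply: (scalerI n0); rewrite exp_term_succ IH linear_sum /= scaler_sumr.
pose F i := lie (exp_term t i x) (exp_term t (n.+1 - i) y).
have -> : n.+1%:R *: (\sum_(i < n.+2) F i) =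
    \sum_(i < n.+1) (i.+1%:R *: F i.+1) + \sum_(i < n.+1) ((n.+1 - i)%:R *: F i).
  have -> : \sum_(i < n.+1) (n.+1 - i)%:R *: F i = \sum_(i < n.+2) (n.+1 - i)%:R *: F i.
    by rewrite [RHS]big_ord_recr/= subnn scale0r addr0.
  have -> : \sum_(i < n.+1) (i.+1%:R *: F i.+1) = \sum_(i < n.+2) i%:R *: F i.
    by rewrite [RHS]big_ord_recl/= scale0r add0r.
  rewrite scaler_sumr -big_split/=; apply: eq_bigr => i _.
  by rewrite -scalerDl -natrD subnKC// -ltnS.
rewrite -big_split/=; apply: eq_bigr => i _.
rewrite /F subSS D_derivation scalerDr -(lieZl t) -(lieZr t) -!exp_term_succ lieZl lieZr.
by rewrite subSn// -ltnS.
Qed.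

Lemma exp_map_lie t x y : exp_map t (lie x y) = lie (exp_map t x) (exp_map t y).
Proof.
have [k k0 kP] := @lie_rbounded R L.
have bnd i j : rnorm (lie (exp_term t i x) (exp_term t j y)) <=
    k * rnorm x * rnorm y * (exp_coeff (cmod t * C) i * exp_coeff (cmod t * C) j).
  have := rnorm_exp_term t i x; have := rnorm_exp_term t j y.
  move: (exp_coeff _ i) (exp_coeff _ j) => p q hj hi.
  rewrite (le_trans (kP _ _))// (_ : _ * (p * q) = k * ((p * rnorm x) * (q * rnorm y))).
    by rewrite -mulrA ler_wpM2l ?(ltW k0)// ler_pM ?rnorm_ge0.
  by ring.
have h := rcvgD (square_sum_cvg0 (tC0 t) bnd) (exp_mapP t (lie x y)).
apply: rcvg_unique (rcvg_lie (exp_mapP t x) (exp_mapP t y)).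
move: h; rewrite add0r; congr rcvg; apply/funext => n.
rewrite [X in _ + X](eq_bigr (fun k => \sum_(i < k.+1) lie (exp_term t i x) (exp_term t (k - i) y))).
  rewrite subrK [RHS]lie_suml; apply: eq_bigr => i _; by rewrite lie_sumr.
by move=> i _; exact: exp_term_lie.
Qed.

(** [D x] is the limit of t^-1 (exp(tD) x - x) as t tends to 0, and these quotients lie in [Z]. *)
Lemma stable_of_exp_map Z : linear_subspace Z -> closed Z ->
  (forall t, stable_under (exp_map t) Z) -> stable_under D Z.
Proof.
move=> sZ /closed_approxP cZ eZ x Zx; apply: cZ => e e0.
pose B := expR C * rnorm x.
have B0 : 0 <= B by rewrite mulr_ge0 ?expR_ge0 ?rnorm_ge0.
have B1 : 0 < B + 1 by lra.
(* This makes [r * B < e] within the range |t| <= 1 of [exp_map_derivative]; [B + 1] avoids dividing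
   by zero. *)
pose r := Num.min 1 (e / (B + 1)).
have r0 : 0 < r by rewrite lt_min ltr01 divr_gt0.
have r1 : r <= 1 by rewrite ge_min lexx.
have re : r * B < e.
  have : r * (B + 1) <= e by rewrite -ler_pdivlMr// ge_min lexx orbT.
  by apply: lt_le_trans; rewrite ltr_pM2l// ltrDl.
pose t : R[i] := r%:C.
have ct : cmod t = r by rewrite /t cmod_real gtr0_norm.
have tn0 : t != 0 by rewrite -cmod_gt0 ct.
exists (t^-1 *: (exp_map t x - x)).
  by apply: subspaceZ => //; apply: subspaceB => //; exact: eZ.
rewrite (_ : _ - _ = - (t^-1 *: (exp_map t x - x - t *: D x))); last first.
  by rewrite [in RHS]scalerBr scalerA mulVf// scale1r opprB.
rewrite rnormN rnormZ cmodV ct; apply: le_lt_trans re.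
rewrite ler_pdivrMl//; have := @exp_map_derivative t x; rewrite ct => /(_ r1).
by [].
Qed.

End exponential.

(** * Maximal subalgebras contain ideals of finite codimension *)

Section maximal_subalgebras.
Context {R : realType} {L : banachLieType R}.
Implicit Types S T : set L.

Definition lie_absorbing S := forall a b, S b -> S (lie a b).

(** Closedness of [T] comes from [closed_superspace], so maximality can be tested on algebraic
    subalgebras. *)
Lemma maximal_dichotomy S T : maximal_members (@finite_codim_subalgebras R L) S ->
  linear_subspace T -> S `<=` T -> (forall a b, T a -> T b -> T (lie a b)) ->
  T = S \/ T = setT.
Proof.
move=> [[[sS cS lS] S1 fS] Smax] sT ST lT.
have [->|T1] := pselect (T = setT); first by right.
left; apply: Smax => //; split=> //; last exact: finite_codimS fS.
by split=> //; exact: closed_superspace fS ST.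
Qed.

(** The normalizer of [S] is a subalgebra strictly larger than [S], hence everything. *)
Lemma maximal_normalizer S x : maximal_members (@finite_codim_subalgebras R L) S ->
  (forall s, S s -> S (lie s x)) -> ~ S x -> lie_absorbing S.
Proof.
move=> Smax Sx nSx; have [[[sS _ lS] _ _] _] := Smax.
pose T : set L := [set y | forall s, S s -> S (lie s y)].
have [|||TS|TT] := @maximal_dichotomy S T Smax.
- split=> [s _|k y z Ty Tz s Ss]; first by rewrite lie0r; exact: subspace0.
  by rewrite lieDr lieZr; apply: sS.2; [exact: Ty|exact: Tz].
- by move=> y Sy s Ss; exact: lS.
- move=> a b Ta Tb s Ss; rewrite lie_derivation; apply: subspaceD => //.
    exact/Tb/Ta.
  by rewrite lieC; apply: subspaceN => //; exact/Ta/Tb.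
- by case: nSx; have : T x by []; rewrite TS.
- move=> a b Sb; rewrite lieC; apply: subspaceN => //.
  by have Ta : T a by [rewrite TT]; exact: Ta.
Qed.

Lemma subspace_kernel (f : {linear L -> R[i]^o}) : linear_subspace [set x | f x = 0].
Proof.
split=> [|k x y /= fx fy]; first exact: linear0.
by rewrite linearP fx fy scaler0 addr0.
Qed.

(** The radical [T] of the form f [x, y] is a subalgebra containing [S]. If [T = S], the form is
    nondegenerate on L / S, and the vector [x1] representing [f] normalizes [S]. If [T] is
    everything, the kernel of [f] is a subalgebra containing [S] and all brackets: it is [S], which
    is then an ideal, or the whole algebra. *)
Lemma maximal_invariant_functional S (f : {linear L -> R[i]^o}) :
  maximal_members (@finite_codim_subalgebras R L) S -> ~ lie_absorbing S ->
  (forall s, S s -> f s = 0) -> (forall s x, S s -> f (lie s x) = 0) ->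
  forall x, f x = 0.
Proof.
move=> Smax nS fS fSL; have [[[sS cS lS] S1 fcS] _] := Smax.
apply: contrapT => /existsNP[x0 fx0].
pose T : set L := [set x | forall y, f (lie x y) = 0].
have [|||TS|TT] := @maximal_dichotomy S T Smax.
- split=> [y|k y z Ty Tz u]; first by rewrite lie0l linear0.
  by rewrite lieDl lieZl linearP Ty Tz scaler0 addr0.
- by move=> s Ss y; exact: fSL.
- move=> a b Ta Tb y; have := lie_derivation a b y.
  move/(congr1 f); rewrite Ta linearD /= => /esym/eqP; rewrite Tb addr0 => /eqP.
  by [].
- have [n [e [c [cS' We cK]]]] := finite_codim_coords sS fcS.
  pose Om : 'M[R[i]]_n := \matrix_(i, j) f (lie (e i) (e j)).
  have gE x j : (c x *m Om) 0 j = f (lie x (e j)).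
    have := fSL _ (e j) (We x); rewrite lieBl linearB /= => /eqP.
    rewrite subr_eq0 => /eqP ->; rewrite lie_suml linear_sum mxE /=.
    by apply: eq_bigr => i _; rewrite mxE lieZl linearZ.
  have ext x y : (forall j, f (lie x (e j)) = f (lie y (e j))) ->
      forall z, f (lie x z) = f (lie y z).
    have expand u z : f (lie u z) = \sum_j c z 0 j * f (lie u (e j)).
      have Sz := We z; have := fSL _ u Sz; rewrite lieC linearN => /eqP.
      rewrite oppr_eq0 lieBr linearB /= subr_eq0 => /eqP ->.
      by rewrite lie_sumr linear_sum; apply: eq_bigr => j _; rewrite lieZr linearZ.
    by move=> xy z; rewrite !expand; apply: eq_bigr => j _; rewrite xy.
  have Omu : Om \in unitmx.
    rewrite -row_free_unit; apply: inj_row_free => v vOm.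
    rewrite -(cK v); apply/cS'; rewrite -TS => y.
    rewrite (ext _ 0) ?lie0l ?linear0// => j.
    by rewrite -gE cK vOm mxE lie0l linear0.
  pose x1 := \sum_i ((\row_j f (e j)) *m invmx Om) 0 i *: e i.
  have x1f y : f (lie x1 y) = f y.
    have hj j : f (lie x1 (e j)) = f (e j) by rewrite -gE cK mulmxKV// mxE.
    have Sy := We y; have := fSL _ x1 Sy.
    rewrite lieC (linE f) lieBr !(linE f) => /eqP; rewrite oppr_eq0 subr_eq0 => /eqP ->.
    have := fS _ Sy; rewrite !(linE f) => /eqP; rewrite subr_eq0 => /eqP ->.
    rewrite lie_sumr !linear_sum.
    by apply: eq_bigr => j _; rewrite lieZr !linearZ /= hj.
  (* f [[s, x1], y] = f [s, [x1, y]] - f [x1, [s, y]], where the second term is f [s, y]; both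
     vanish, so [s, x1] is in [T = S]. *)
  apply: nS; apply: (maximal_normalizer Smax (x := x1)) => [s Ss|Sx1].
    rewrite -TS => y; have := lie_derivation s x1 y => /(congr1 f).
    rewrite linearD /= x1f !(fSL s _ Ss) => /esym/eqP.
    by rewrite addr0 => /eqP.
  by apply: fx0; rewrite -x1f fSL.
- have [|||KS|KT] := @maximal_dichotomy S [set x | f x = 0] Smax.
  + exact: subspace_kernel.
  + exact: fS.
  + by move=> a b _ _; have Ta : T a by [rewrite TT]; exact: Ta.
  + apply: nS => a b _; rewrite -KS /=.
    by have Ta : T a by [rewrite TT]; exact: Ta.
  + by apply: fx0; have K0 : [set x | f x = 0] x0 by [rewrite KT]; exact: K0.
Qed.

End maximal_subalgebras.

(** * Products of adjoint operators and the filtration they define *)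

Section words.
Context {R : realType} {L : banachLieType R}.
Implicit Types (w u v : seq L) (x y z : L).

Definition act w x := foldr lie x w.

Lemma act_linear w : linear (act w).
Proof. by elim: w => [//|y w IH] k x z /=; rewrite IH linearP. Qed.

HB.instance Definition _ w := GRing.isLinear.Build _ _ _ _ _ (act_linear w).

Lemma act_cat u w x : act (u ++ w) x = act u (act w x).
Proof. exact: foldr_cat. Qed.

Lemma act_bounded w : bounded_map (act w).
Proof.
elim: w => [|y w IH]; first by exists 1 => // x; rewrite mul1r.
exact: (bounded_comp (lie_bound y) IH).
Qed.

End words.

Section filtration.
Context {R : realType} {L : banachLieType R} (S : set L).
Hypothesis S_subalgebra : closed_lie_subalgebra S.
Hypothesis S_codim : finite_codim S.
Implicit Types (w u v : seq L) (x y z h : L) (n k : nat).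

Let sS : linear_subspace S. Proof. by case: S_subalgebra. Qed.

(** A descending chain with [fil 0] the whole algebra and [fil 1] equal to [S]. *)
Definition fil n : set L := [set x | forall w, (size w < n)%N -> S (act w x)].

Lemma fil_sub n x : fil n.+1 x -> S x.
Proof. by move/(_ [::]); exact. Qed.

Lemma fil_lie n x y : fil n.+1 x -> fil n (lie y x).
Proof.
move=> xn w wn; have := xn (rcons w y); rewrite size_rcons => /(_ wn).
by rewrite -cats1 act_cat.
Qed.

Lemma fil_intro n x : S x -> (forall y, fil n (lie y x)) -> fil n.+1 x.
Proof.
move=> Sx xn w; case/lastP: w => [//|w y]; rewrite size_rcons => wn.
by rewrite -cats1 act_cat; exact: xn.
Qed.

Lemma subspace_fil n : linear_subspace (fil n).
Proof.
split=> [w _|k x y xn yn w wn]; first by rewrite linear0; exact: subspace0.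
by rewrite linearP; apply: sS.2; [exact: xn|exact: yn].
Qed.

Lemma closed_fil n : closed (fil n).
Proof.
have -> : fil n = \bigcap_(w in [set w | (size w < n)%N]) (act w @^-1` S) by [].
apply: closed_bigI => w _; apply: closed_preimage_bounded; first exact: act_bounded.
by case: S_subalgebra.
Qed.

Lemma fil_stable n h : S h -> stable_under (lie h) (fil n).
Proof.
move=> Sh; elim: n => [//|n IH] x xn; apply: fil_intro.
  by case: S_subalgebra => _ _; apply => //; exact: fil_sub xn.
move=> y; rewrite lie_derivation; apply: (subspaceD (subspace_fil n)).
  exact: fil_lie.
exact/IH/fil_lie.
Qed.

Lemma fil_lie_spanned n m (e : 'I_m -> L) (c : L -> 'I_m -> R[i]) x y :
  (forall y, S (y - \sum_i c y i *: e i)) ->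
  fil n x -> (forall i, fil n (lie (e i) x)) -> fil n (lie y x).
Proof.
move=> Se xn ex; rewrite -[y](subrK (\sum_i c y i *: e i)) lieDl lie_suml.
apply: (subspaceD (subspace_fil n)); first exact: fil_stable.
apply: (subspace_sum (subspace_fil n)) => i _; rewrite lieZl.
exact: (subspaceZ (subspace_fil n)).
Qed.

(** Since [S] preserves [fil n], brackets with the finitely many [e i] decide whether an element of
    [S] and [fil n] belongs to [fil n.+1]. *)
Lemma fil_codim n : finite_codim (fil n).
Proof.
elim: n => [|n IH]; first exact: finite_codimS (@finite_codimT _ _).
have [m [e /choice[c Se]]] := S_codim.
have : finite_codim ((S `&` fil n) `&` [set x | forall i, i \in enum 'I_m -> fil n (lie (e i) x)]).
  elim: (enum 'I_m) => [|i s IHs].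
    apply: finite_codimS (finite_codimI sS (subspace_fil n) S_codim IH).
    by move=> x Sx; split.
  have fi : finite_codim (lie (e i) @^-1` fil n).
    exact: finite_codim_preimage (subspace_fil n) IH.
  apply: finite_codimS (finite_codimI _ _ IHs fi).
  - move=> x [[Sx xs] xi]; split=> // j; rewrite in_cons => /orP[/eqP ->//|]; exact: xs.
  - apply: subspaceI; first exact: subspaceI (subspace_fil n).
    split=> [j _|k x y xs ys j js]; first by rewrite lie0r; exact: subspace0 (subspace_fil n).
    by rewrite linearP; apply: (subspace_fil n).2; [exact: xs|exact: ys].
  - exact: subspace_preimage (subspace_fil n).
apply: finite_codimS => x [[Sx xn] ex]; apply: fil_intro => // y.
by apply: (fil_lie_spanned y Se) => // i; apply: ex; rewrite mem_enum.
Qed.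

Lemma act_fil n w x : fil (n + size w) x -> fil n (act w x).
Proof.
elim: w n => [|y w IH] n /=; first by rewrite addn0.
by rewrite addnS -addSn => /IH; exact: fil_lie.
Qed.

(** The product [act w] is zero on the associated graded space: in general it only reaches
    [fil n]. *)
Definition nil_word w := forall n x, fil (n + size w) x -> fil n.+1 (act w x).

Lemma nil_word_catl u w : nil_word w -> nil_word (u ++ w).
Proof.
move=> nw n x; rewrite size_cat addnA act_cat => /nw.
by rewrite -addSn => /act_fil.
Qed.

Lemma nil_word_catr u w : nil_word w -> nil_word (w ++ u).
Proof.
move=> nw n x; rewrite size_cat addnA act_cat => xn.
exact/nw/act_fil.
Qed.

Lemma nil_word_sub s : S s -> nil_word [:: s].
Proof. by move=> Ss n x; rewrite addn1 /=; exact: fil_stable. Qed.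

(** Exchanging neighbours y and z costs ad [y, z], one operator in place of two, so the error lies
    one step deeper. *)
Lemma act_move_front n y u v x : fil (n + (size u + size v).+1) x ->
  fil n.+1 (act (y :: u ++ v) x - act (u ++ y :: v) x).
Proof.
elim: u n => [|z u IH] n /=.
  by rewrite subrr => _; exact: subspace0 (subspace_fil _).
rewrite addSn addnS -addSn => xn.
rewrite -(subrK (lie z (act (y :: u ++ v) x)) (lie y _)) -addrA -linearB.
apply: (subspaceD (subspace_fil _)); last exact/fil_lie/IH.
rewrite /= lie_derivation addrK; apply: fil_lie.
have := @act_fil n.+2 (u ++ v) x; rewrite size_cat; apply.
by move: xn; rewrite addSn addnS addSn.
Qed.

Lemma act_perm n w u x : perm_eq w u -> fil (n + size w) x ->
  fil n.+1 (act w x - act u x).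
Proof.
elim: w u n => [|y w IH] u n wu.
  rewrite perm_sym in wu; rewrite (perm_nilP wu) subrr => _.
  exact: subspace0 (subspace_fil _).
have yu : y \in u by rewrite -(perm_mem wu) mem_head.
case/splitPr: yu wu => u1 u2; rewrite perm_sym perm_catC/= perm_cons perm_catC perm_sym.
move=> wu /= xn; rewrite -(subrK (act (y :: u1 ++ u2) x) (lie y _)) -addrA.
apply: (subspaceD (subspace_fil _)).
  rewrite /= -lieBr; apply: fil_lie; apply: IH wu _.
  by rewrite addSn -addnS.
by apply: act_move_front; rewrite -size_cat -(perm_size wu).
Qed.

Lemma nil_word_perm w u : perm_eq w u -> nil_word w -> nil_word u.
Proof.
move=> wu nw n x; rewrite -(perm_size wu) => xn.
by apply/(subspace_sub (subspace_fil _) (act_perm wu xn)); exact: nw.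
Qed.

Definition nil_elements : set L := [set x | exists k, nil_word (nseq k x)].

Lemma nil_word_nseq k m x : (k <= m)%N -> nil_word (nseq k x) -> nil_word (nseq m x).
Proof. by move=> /subnK <- nk; rewrite nseqD; exact: nil_word_catl. Qed.

(** Order is irrelevant on the graded space, so a word of length at least k + K can be sorted: it
    has at least [k] letters [e] or at least [K] letters from the rest. *)
Lemma nil_words_over (E : seq L) : (forall x, x \in E -> nil_elements x) ->
  exists K, forall w, {subset w <= E} -> (K <= size w)%N -> nil_word w.
Proof.
elim: E => [|e E IH] nE.
  by exists 1%N => -[//|x w] wE; have := wE x (mem_head _ _).
have [K KP] := IH (fun x xE => nE x (mem_behead (s := e :: E) xE)).
have [k kP] := nE e (mem_head _ _).
exists (k + K)%N => w wE wK.
have ew := perm_filterC (pred1 e) w.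
apply: (nil_word_perm (permEl ew)).
have [kc|kc] := leqP k (size [seq x <- w | pred1 e x]).
  apply: nil_word_catr; have /all_pred1P -> := filter_all (pred1 e) w.
  exact: nil_word_nseq kP.
apply: nil_word_catl; apply: KP.
  by move=> x; rewrite mem_filter /= => /andP[/negPf xe /wE]; rewrite in_cons xe.
have := perm_size (permEl ew); rewrite size_cat => h.
by rewrite -(leq_add2l k) (leq_trans wK)// -h leq_add2r ltnW.
Qed.

(** The power of [c *: a + b] is expanded one letter at a time, down to words of length [K] in [a]
    and [b]. *)
Lemma nil_word_combination (c : R[i]) (a b : L) K :
  (forall w, {subset w <= [:: a; b]} -> (K <= size w)%N -> nil_word w) ->
  nil_word (nseq K (c *: a + b)).
Proof.
move=> nw; suff : forall i j w, (i + j = K)%N -> {subset w <= [:: a; b]} -> size w = j ->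
    nil_word (nseq i (c *: a + b) ++ w).
  by move/(_ K 0%N [::]); rewrite cats0; apply => //; rewrite addn0.
elim=> [|i IH] j w ijK wab wj; first by apply: nw; rewrite ?wj -?ijK.
have IHz z : z \in [:: a; b] -> nil_word (nseq i (c *: a + b) ++ z :: w).
  move=> zab; apply: (IH j.+1); [lia| |by rewrite /= wj].
  by move=> y; rewrite in_cons => /orP[/eqP ->//|]; exact: wab.
rewrite -addn1 nseqD -catA /= => n x xn.
have sz z : size (nseq i (c *: a + b) ++ z :: w) = size (nseq i (c *: a + b) ++ (c *: a + b) :: w).
  by rewrite !size_cat.
rewrite act_cat /= lieDl lieZl linearP -!/(act _ _).
apply: (subspace_fil _).2.
  have := @IHz a (mem_head _ _) n x; rewrite act_cat; apply.
  by rewrite sz.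
have := @IHz b _ n x; rewrite act_cat; apply; last by rewrite sz.
by rewrite !in_cons eqxx orbT.
Qed.

Lemma subspace_nil_elements : linear_subspace nil_elements.
Proof.
split; first by exists 1%N; apply: (nil_word_sub (s := 0)); exact: subspace0.
move=> k a b na nb.
have [|K KP] := @nil_words_over [:: a; b].
  by move=> x; rewrite !inE => /orP[] /eqP ->.
by exists K; exact: nil_word_combination.
Qed.

Lemma sub_nil_elements : S `<=` nil_elements.
Proof. by move=> s Ss; exists 1%N; exact: nil_word_sub. Qed.

End filtration.

(** * Products of root vectors *)

Section root_words.
Context {R : realType} {L : banachLieType R} (S : set L).
Hypotheses (S_subalgebra : closed_lie_subalgebra S) (S_codim : finite_codim S).
Variables (h : L) (Sh : S h) (lambda : R[i]) (v : nat -> L).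
Hypothesis vS : forall i, lie h (v i) = lambda *: v i + v i.+1.

Let sS : linear_subspace S. Proof. by case: S_subalgebra. Qed.

Definition word (I : seq nat) := [seq v i | i <- I].

Fixpoint bumps (I : seq nat) : seq (seq nat) :=
  if I is i :: J then (i.+1 :: J) :: [seq i :: K | K <- bumps J] else [::].

Lemma bumps_size I J : J \in bumps I -> size J = size I /\ sumn J = (sumn I).+1.
Proof.
elim: I J => [//|i I IH] J /=; rewrite in_cons => /orP[/eqP ->//|/mapP[K /IH[KI KS] ->]] /=.
by rewrite KI KS addnS.
Qed.

Lemma lie_act_word I x :
  lie h (act (word I) x) = act (word I) (lie h x) +
    (((size I)%:R * lambda) *: act (word I) x + \sum_(J <- bumps I) act (word J) x).
Proof.
elim: I => [|i I IH] /=; first by rewrite mul0r scale0r big_nil !addr0.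
rewrite lie_derivation vS IH lieDl lieZl !lieDr lieZr.
rewrite big_cons big_map lie_sumr -natr1 mulrDl mul1r scalerDl /=.
set A := lie (v i) (act _ _); set B := lie (v i) (act _ _); set E := lie (v i.+1) _.
set X := \sum_(_ <- _) _.
by rewrite addrCA addrACA (addrC (lambda *: A)).
Qed.

(* With [v i = (ad h - lambda)^i x], ad h multiplies a word of length m by     *)
(* m lambda up to words with one index raised, and words with an index >= a   *)
(* are trivial: hence the downward induction on the sum of the indices.       *)
Lemma root_word_nil a m I : S (v a) -> (forall i, S (v i) -> S (v i.+1)) ->
  (exists2 C : R, 0 <= C & (forall y, rnorm (lie h y) <= C * rnorm y) /\
     2 * C < cmod (m%:R * lambda)) ->
  size I = m -> nil_word S (word I).
Proof.
move=> Sva Sv [C C0 [hC Cm]].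
have Svi i : (a <= i)%N -> S (v i) by move=> /subnK <-; elim: (i - a)%N => //= k; exact: Sv.
suff : forall d I, size I = m -> (a * m <= sumn I + d)%N -> nil_word S (word I).
  by move/(_ (a * m)%N I) => + Im; apply => //; exact: leq_addl.
elim=> [|d IH] {}I Im Id.
  have [/hasP[i iI ai]|/hasPn nI] := boolP (has (fun i => a <= i)%N I).
    case/splitPr: iI Im Id => I1 I2 _ _; rewrite /word map_cat /=.
    apply: nil_word_catl => //; rewrite -cat1s; apply: nil_word_catr => //.
    by apply: nil_word_sub => //; exact: Svi.
  (* If all indices are below [a], then sumn I + m <= a * m, contradicting a * m <= sumn I once m >
     0; for m = 0 the hypothesis [Cm] would say 2 * C < 0. *)
  exfalso; have m0 : (0 < m)%N.
    case: (m) Cm => //; rewrite mul0r (eqP (_ : cmod 0 == 0)) ?cmod_eq0// ltNge.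
    by rewrite mulr_ge0.
  have : (sumn I + size I <= a * size I)%N.
    elim: I {Im Id} nI => [|i I IHI] nI /=; first by rewrite muln0.
    have ia : (i < a)%N by rewrite ltnNge nI ?mem_head.
    have := IHI (fun j jI => nI j (mem_behead (s := i :: I) jI)); rewrite mulnS; lia.
  by rewrite Im; lia.
have Jnil J : J \in bumps I -> nil_word S (word J).
  by move=> /bumps_size[JI JS]; apply: IH; rewrite ?JI// JS; lia.
move=> n; rewrite size_map Im.
apply: (@intertwining_vanishes _ _ (lie h) (act (word I)) C (m%:R * lambda)) => //.
- exact: act_bounded.
- exact: subspace_fil.
- exact: closed_fil.
- exact: fil_codim.
- exact: fil_stable.
- exact: subspace_fil.
- exact: closed_fil.
- exact: fil_codim.
- exact: fil_stable.
move=> x xn /=; rewrite lie_act_word Im [X in X - _ - _]addrC addrK [X in X - _]addrC addrK.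
rewrite big_seq; apply: (subspace_sum (subspace_fil _ _)) => // J JI.
by apply: (Jnil J JI); rewrite size_map (bumps_size JI).1 Im.
Qed.

End root_words.

Section linear_span.
Context {R : realType} {L : banachLieType R}.
Implicit Types X V : set L.

Definition linear_span X : set L :=
  [set x | forall V, linear_subspace V -> X `<=` V -> V x].

Lemma subspace_linear_span X : linear_subspace (linear_span X).
Proof.
split=> [V sV _|k x y Xx Xy V sV XV]; first exact: subspace0.
by apply: sV.2; [exact: Xx|exact: Xy].
Qed.

Lemma sub_linear_span X : X `<=` linear_span X.
Proof. by move=> x Xx V _; apply. Qed.

End linear_span.

(** * Root vectors of a maximal subalgebra and their span *)

Section core.
Context {R : realType} {L : banachLieType R} (S : set L).
Hypothesis Smax : maximal_members (@finite_codim_subalgebras R L) S.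

Let S_subalgebra : closed_lie_subalgebra S. Proof. by case: Smax => -[]. Qed.
Let S_codim : finite_codim S. Proof. by case: Smax => -[]. Qed.
Let sS : linear_subspace S. Proof. by case: S_subalgebra. Qed.

Lemma root_space_nil h lambda : S h -> lambda != 0 ->
  root_space (lie h) S lambda `<=` nil_elements S.
Proof.
move=> Sh l0 x [a Sa].
have [C C0 hC] := lie_bound h.
pose v i := shifted (lie h) (nseq i lambda) x.
have vS i : lie h (v i) = lambda *: v i + v i.+1 by rewrite /v /= addrC subrK.
have cl : 0 < cmod lambda by rewrite cmod_gt0.
(* At this length the total shift m lambda exceeds twice the bound [C] on ad h. *)
pose m := Num.bound (2 * C / cmod lambda).
have Cm : 2 * C < cmod (m%:R * lambda).
  rewrite cmodM cmod_nat -ltr_pdivrMr//.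
  by apply: archi_boundP; rewrite divr_ge0 ?mulr_ge0// ltW.
exists m; rewrite (_ : nseq m x = word v (nseq m 0%N)); last by rewrite /word map_nseq.
apply: (@root_word_nil _ _ _ S_subalgebra S_codim h Sh lambda v vS a m) => //.
- move=> i Si; apply: subspaceB => //; last exact: subspaceZ.
  by case: S_subalgebra => _ _; apply.
- by exists C.
- by rewrite size_nseq.
Qed.

Definition root_span : set L := linear_span
  (S `|` [set x | exists (h : L) (lambda : R[i]), [/\ S h, lambda != 0 & root_space (lie h) S lambda x]]).

Lemma sub_root_span : S `<=` root_span.
Proof. by move=> s Ss; apply: sub_linear_span; left. Qed.

Lemma root_span_nil : root_span `<=` nil_elements S.
Proof.
move=> x; apply; first exact: subspace_nil_elements.
move=> y [Sy|[h [l [Sh l0 hy]]]]; first exact: sub_nil_elements.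
exact: root_space_nil hy.
Qed.

(** The automorphism E = exp(t ad k) preserves [S] and carries root vectors of h to root vectors of
    E h for the same root; [stable_of_exp_map] then passes from E to ad k. *)
Lemma root_span_stable k : S k -> stable_under (lie k) root_span.
Proof.
move=> Sk; have [C C0 kC] := lie_bound k.
have rspan : linear_subspace root_span by exact: subspace_linear_span.
apply: (@stable_of_exp_map _ _ (lie k) C C0 kC); first exact: rspan.
  apply: closed_superspace S_codim sub_root_span => //.
  by case: S_subalgebra.
move=> t x; pose E := exp_map C0 kC t : {linear L -> L}.
have ES s : S s -> S (E s).
  apply: exp_map_stable => //; first by case: S_subalgebra.
  by move=> y; case: S_subalgebra => _ _; apply.
have Elie a b : E (lie a b) = lie (E a) (E b).
  by apply: exp_map_lie => y z; exact: lie_derivation.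
move=> Wx; apply: (Wx (E @^-1` root_span)).
  by apply: subspace_preimage; exact: subspace_linear_span.
move=> y [Sy|[h [l [Sh l0 [a hy]]]]]; first by apply: sub_root_span; exact: ES.
apply: sub_linear_span; right; exists (E h), l; split=> //; first exact: ES.
exists a; rewrite (_ : shifted _ _ _ = E (shifted (lie h) (nseq a l) y)); first exact: ES.
by elim: a {hy} => //= a ->; rewrite !(linE E) Elie.
Qed.

End core.

Lemma nilpotent_of_eigenvalues (F : closedFieldType) n (A : 'M[F]_n.+1) :
  (forall l, eigenvalue A l -> l = 0) -> A ^+ n.+1 = 0.
Proof.
move=> eA; have [s ps] := closed_field_poly_normal (char_poly A).
rewrite (monicP (char_poly_monic A)) scale1r in ps.
have s0 z : z \in s -> z = 0.
  by move=> zs; apply: eA; rewrite eigenvalue_root_char ps root_prod_XsubC.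
have {}ps : char_poly A = 'X^(size s).
  rewrite ps (eq_big_seq (fun=> 'X)) => [|z /s0 ->]; last by rewrite subr0.
  by rewrite big_const_seq count_predT iter_mulr_1.
have sz : size s = n.+1.
  by have := size_char_poly A; rewrite ps size_polyXn => -[].
by have := Cayley_Hamilton A; rewrite ps sz rmorphXn /= horner_mx_X.
Qed.

(** * The ideal inside a maximal subalgebra *)

Section core.
Context {R : realType} {L : banachLieType R} (S : set L).
Hypothesis Smax : maximal_members (@finite_codim_subalgebras R L) S.

Let S_subalgebra : closed_lie_subalgebra S. Proof. by case: Smax => -[]. Qed.
Let S_codim : finite_codim S. Proof. by case: Smax => -[]. Qed.
Let sS : linear_subspace S. Proof. by case: S_subalgebra. Qed.

(** On the quotient by the span W every ad h has only the eigenvalue 0, since by [eigenvector_lift]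
    other eigenvectors come from W. If the quotient were nonzero, Engel would give a nonzero column
    u killed by all these matrices, hence a functional killing [S] and [S, L]; it vanishes, so u =
    0. *)
Lemma root_span_full : ~ lie_absorbing S -> forall x, root_span S x.
Proof.
move=> nS; pose W := root_span S.
have sW : linear_subspace W by exact: subspace_linear_span.
have SW : S `<=` W by exact: sub_root_span.
have fW : finite_codim W by exact: finite_codimS S_codim.
have [n [e [c [cW We cK]]]] := finite_codim_coords sW fW.
case: n e c cW We cK => [|n] e c cW We cK.
  by move=> x; apply/cW/rowP => -[].
pose G : set 'M[R[i]]_n.+1 :=
  [set A | exists2 h, S h & forall x, c (lie h x) = c x *m A].
have [|k A B [h Sh hA] [g Sg gB]|A B [h Sh hA] [g Sg gB]|A [h Sh hA]|u u0 Gu] := @engel _ _ G.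
- by exists 0 => [|x]; [exact: subspace0|rewrite lie0l linear0 mulmx0].
- exists (k *: h + g) => [|x]; first exact: sS.2.
  by rewrite lieDl lieZl linearP hA gB mulmxDr -scalemxAr.
(* The bracket is [lie g h] because matrices act on rows from the right. *)
- exists (lie g h) => [|x]; first by case: S_subalgebra => _ _; apply.
  have := lie_derivation g h x => /esym/(canRL (addrK _)) ->.
  by rewrite linearB /= gB hA hA gB mulmxBr !mulmxA.
- exists n.+1; apply: nilpotent_of_eigenvalues => l /eigenvalueP[r rA r0].
  apply/eqP/negPn/negP => l0; pose x := \sum_i r 0 i *: e i.
  have Wx : W (lie h x - l *: x).
    by apply/cW; rewrite linearB linearZ /= hA cK rA subrr.
  case/eqP: r0; rewrite -(cK r); apply/cW.
  apply: (@eigenvector_lift _ _ (lie h) S W l x) => //.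
  + by move=> y; case: S_subalgebra => _ _; apply.
  + exact: root_span_stable.
  + by move=> y hy; apply: sub_linear_span; right; exists h, l.
- exfalso; case/eqP: u0; apply/colP => i.
  pose f (x : L) : R[i]^o := (c x *m u) 0 0.
  have flin : linear f.
    by move=> k x y; rewrite /f linearP mulmxDl -scalemxAl !mxE.
  pose fl : {linear L -> R[i]^o} := HB.pack f (GRing.isLinear.Build _ _ _ _ _ flin).
  have f0 x : fl x = 0.
    apply: (maximal_invariant_functional Smax nS) => [s /SW/cW cs|s y Ss].
      by rewrite /= /f cs mul0mx mxE.
    have [A cA] := quotient_matrix (root_span_stable Smax Ss) cW We.
    by rewrite /= /f cA -mulmxA Gu ?mulmx0 ?mxE//; exists s.
  have := f0 (\sum_j (delta_mx 0 i : 'rV[R[i]]_n.+1) 0 j *: e j).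
  by rewrite /= /f cK -rowE !mxE.
Qed.

Theorem maximal_contains_ideal : exists J : set L,
  [/\ closed_lie_ideal J, finite_codim J & J `<=` S].
Proof.
have [aS|nS] := pselect (lie_absorbing S).
  by exists S; split=> //; split=> //; case: S_subalgebra.
have [n [e Se]] := S_codim; have /choice[c Sc] := Se.
have [|K KP] := @nil_words_over _ _ S S_subalgebra [seq e i | i <- enum 'I_n].
  by move=> x _; apply: (root_span_nil Smax); exact: root_span_full.
have step : fil S K.+1 `<=` fil S K.+2.
  (* Membership in the next term can be tested on words in the [e i], as [S] preserves each term. At
     length [K] these words are nil, so two consecutive terms agree, and such a term is an ideal. *)
  suff : forall j x, fil S (1 + j)%N x -> (forall w, {subset w <= [seq e i | i <- enum 'I_n]} ->
      size w = j -> fil S 2 (act w x)) -> fil S (1 + j).+1 x.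
    move/(_ K) => h x xK; apply: h => // w we wK.
    by apply: (KP w we _ 1%N); rewrite ?wK.
  elim=> [|j IH] x xj hx; first exact: (hx [::]).
  have ej i : fil S (1 + j).+1 (lie (e i) x).
    apply: IH => [|w we wj]; first by apply: fil_lie; rewrite addnS in xj.
    rewrite -[act w _]/(act w (act [:: e i] x)) -act_cat; apply: hx.
      move=> y; rewrite mem_cat inE => /orP[/we//|/eqP ->].
      by apply/map_f; rewrite mem_enum.
    by rewrite size_cat addn1 wj.
  rewrite addnS; apply: fil_intro; first exact: fil_sub xj.
  move=> y; apply: (fil_lie_spanned S_subalgebra (e := e) (c := c)) => //.
exists (fil S K.+1); split.
- split; [exact: subspace_fil|exact: closed_fil|].
  by move=> a b /step; exact: fil_lie.
- exact: fil_codim.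
- by move=> x; exact: fil_sub.
Qed.

End core.

(** * The four maps *)

(** The range is arbitrary, so that inclusions of subalgebras are covered. *)
Definition lie_hom {R : realType} {A B : banachLieType R} (f : {linear A -> B}) :=
  (forall a b, f (lie a b) = lie (f a) (f b)) /\ bounded_map f.

Section lie_homs.
Context {R : realType} {A B : banachLieType R} (f : {linear A -> B}).
Hypothesis fh : lie_hom f.

Lemma preimage_subalgebra (S : set B) :
  closed_lie_subalgebra S -> closed_lie_subalgebra (f @^-1` S).
Proof.
move=> [sS cS lS]; split; first exact: subspace_preimage.
  by apply: closed_preimage_bounded => //; exact: fh.2.
by move=> a b Sa Sb; rewrite /preimage /= fh.1; exact: lS.
Qed.

Lemma preimage_ideal (I : set B) : closed_lie_ideal I -> closed_lie_ideal (f @^-1` I).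
Proof.
move=> [sI cI lI]; split; first exact: subspace_preimage.
  by apply: closed_preimage_bounded => //; exact: fh.2.
by move=> a b Ib; rewrite /preimage /= fh.1; exact: lI.
Qed.

Lemma P_S_hom a : subalg_set (P_S A) a -> subalg_set (P_S B) (f a).
Proof.
move=> Pa S [aS _ fS]; have [ST|nS] := pselect (f @^-1` S = setT).
  by have : (f @^-1` S) a by rewrite ST.
apply: (Pa (f @^-1` S)); split=> //; first exact: preimage_subalgebra.
by case: aS => sS _ _; exact: finite_codim_preimage.
Qed.

Lemma P_J_hom a : subalg_set (P_J A) a -> subalg_set (P_J B) (f a).
Proof.
move=> Pa I [aI _ fI]; have [IT|nI] := pselect (f @^-1` I = setT).
  by have : (f @^-1` I) a by rewrite IT.
apply: (Pa (f @^-1` I)); split=> //; first exact: preimage_ideal.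
by case: aI => sI _ _; exact: finite_codim_preimage.
Qed.

End lie_homs.

(** * Inclusions between the four maps *)

Section frattini_inclusions.
Context {R : realType}.
Implicit Types L : banachLieType R.

(** A member above [S] of least codimension is maximal, by [codim_le_proper]. *)
Lemma exists_maximal_member L (F : set (set L)) S :
  (forall T, F T -> linear_subspace T /\ finite_codim T) -> F S ->
  exists2 M, maximal_members F M & S `<=` M.
Proof.
move=> Fl FS; pose P n := exists T, [/\ F T, S `<=` T & codim_le n T].
have [n Pn] : exists n, P n.
  by have [_ [n [e Se]]] := Fl S FS; exists n, S; split=> //; exists e.
have [m [[T [FT ST Tm]] mmin]] := ex_min_nat Pn.
exists T => //; split=> // U FU TU; apply/seteqP; split=> // x Ux.
apply: contrapT => nTx.
have [k km Uk] := codim_le_proper (Fl T FT).1 (Fl U FU).1 TU Ux nTx Tm.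
have /mmin : P k by exists U; split=> //; exact: subset_trans TU.
by rewrite leqNgt km.
Qed.

Lemma exists_maximal_subalgebra L S : @finite_codim_subalgebras R L S ->
  exists2 M, maximal_members (@finite_codim_subalgebras R L) M & S `<=` M.
Proof. by apply: exists_maximal_member => T [[sT _ _] _ fT]. Qed.

Lemma exists_maximal_ideal L I : @finite_codim_ideals R L I ->
  exists2 M, maximal_members (@finite_codim_ideals R L) M & I `<=` M.
Proof. by apply: exists_maximal_member => T [[sT _ _] _ fT]. Qed.

Lemma P_S_sub_P_J L : (P_S L : set L) `<=` P_J L.
Proof. by move=> x Px I [cI I1 fI]; apply: Px; split=> //; exact: ideal_subalgebra. Qed.

Lemma P_J_sub_P_Smax L : (P_J L : set L) `<=` P_Smax L.
Proof.
move=> x Px M Mmax; have [J [cJ fJ JM]] := maximal_contains_ideal Mmax.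
apply: (JM); apply: (Px J); split=> // JT; case: Mmax => -[_ nM _] _; apply: nM.
by apply/seteqP; split=> // y _; apply: JM; rewrite JT.
Qed.

Lemma maximal_subalgebra_preimage L (f g : {linear L -> L}) M :
  lie_hom f -> lie_hom g -> cancel f g -> cancel g f ->
  maximal_members (@finite_codim_subalgebras R L) M ->
  maximal_members (@finite_codim_subalgebras R L) (f @^-1` M).
Proof.
move=> fh gh fK gK [[aM nM fM] Mmax].
have preF (h k : {linear L -> L}) T : lie_hom h -> cancel k h ->
    finite_codim_subalgebras T -> finite_codim_subalgebras (h @^-1` T).
  move=> hh kK [aT nT fT]; split; first exact: preimage_subalgebra.
    move=> hT; apply: nT; apply/seteqP; split=> // x _.
    by have : (h @^-1` T) (k x) by [rewrite hT]; rewrite /preimage /= kK.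
  by case: aT => sT _ _; exact: finite_codim_preimage.
split=> [|T FT fMT]; first by apply: (preF f g).
have /(Mmax _ (preF g f T gh fK FT)) <- : M `<=` g @^-1` T.
  by move=> y My; apply: fMT; rewrite /preimage /= gK.
by apply/seteqP; split=> x; rewrite /preimage /= fK.
Qed.

Lemma P_Smax_derivation L (D : {linear L -> L}) : bounded_map D ->
  (forall x y, D (lie x y) = lie (D x) y + lie x (D y)) ->
  stable_under D (P_Smax L).
Proof.
move=> [C C0 DC] Dd; have [sP cP _] := closed_subalgP (P_Smax L).
apply: (@stable_of_exp_map _ _ D C C0 DC) => // t x Px M Mmax.
have eh u : lie_hom (exp_map C0 DC u).
  by split; [exact: exp_map_lie|exact: exp_map_bounded].
apply: (Px (exp_map C0 DC t @^-1` M)).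
apply: (maximal_subalgebra_preimage (eh t) (eh (- t))) Mmax => y.
  exact: exp_mapK.
by have := exp_mapK C0 DC (- t) y; rewrite opprK.
Qed.

(** The second hypothesis says that brackets with [B] preserve the image of [P_Smax A]. It is met by
    the identity and by the inclusions between transfinite powers, the two uses of this lemma. *)
Lemma P_Smax_hom (A B : banachLieType R) (f : {linear A -> B}) : lie_hom f ->
  (forall b a, subalg_set (P_Smax A) a -> exists2 a', subalg_set (P_Smax A) a' & f a' = lie b (f a)) ->
  forall a, subalg_set (P_Smax A) a -> subalg_set (P_Jmax B) (f a).
Proof.
move=> fh fI a Pa I [[[sI cI lI] nI fcI] Imax].
have [sP _ _] := closed_subalgP (P_Smax A).
pose Q : set B := f @` P_Smax A.
have sQ : linear_subspace Q.
  split=> [|k _ _ [x Px <-] [y Py <-]].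
    by exists 0; [exact: subspace0|exact: linear0].
  by exists (k *: x + y); [exact: sP.2|exact: linearP].
pose T := setadd Q I.
have sT : linear_subspace T by exact: subspace_add.
have IT : I `<=` T by exact: setaddr.
have QT : Q `<=` T by exact: setaddl.
have [TT|nT] := pselect (T = setT); last first.
  suff <- : T = I by apply: QT; exists a.
  apply: Imax => //; split=> //; last exact: finite_codimS fcI.
  split=> //; first exact: closed_superspace fcI IT.
  move=> b x [_ [p Pp <-] Ix]; have [p' Pp' fp'] := fI b p Pp.
  exists (f p'); first by exists p'.
  by rewrite fp' -lieBr; exact: lI.
have [NT|nN] := pselect (f @^-1` I = setT).
  by have : (f @^-1` I) a by rewrite NT.
have [|M Mmax NM] := @exists_maximal_subalgebra A (f @^-1` I).
  split=> //; last exact: finite_codim_preimage.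
  by apply: preimage_subalgebra => //; exact: ideal_subalgebra.
(* Here Q + I is all of [B], so each x is the sum of an element of [P_Smax A] and one of the
   preimage of [I]; [M] contains both. *)
have [[[sM _ _] nM _] _] := Mmax; exfalso; apply: nM.
apply/seteqP; split=> // x _.
have [_ [p Pp <-] Ixp] : T (f x) by rewrite TT.
rewrite -[x](subrK p); apply: subspaceD => //; last exact: Pp.
by apply: NM; rewrite /preimage /= linearB.
Qed.

Lemma P_Smax_sub_P_Jmax L : (P_Smax L : set L) `<=` P_Jmax L.
Proof.
have idh : lie_hom (idfun : {linear L -> L}).
  by split=> //; exists 1 => // x; rewrite mul1r.
apply: (P_Smax_hom idh) => b a Pa; exists (lie b a) => //.
apply: (P_Smax_derivation (D := lie b)) Pa; first exact: lie_bound.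
by move=> x y; exact: lie_derivation.
Qed.

Lemma P_Jmax_proper L S : @finite_codim_subalgebras R L S -> (P_Jmax L : set L) <> setT.
Proof.
move=> /exists_maximal_subalgebra[M Mmax _] PT.
have [J [cJ fJ JM]] := maximal_contains_ideal Mmax.
have [|I Imax _] := @exists_maximal_ideal L J.
  split=> // JT; case: Mmax => -[_ nM _] _; apply: nM.
  by apply/seteqP; split=> // y _; apply: JM; rewrite JT.
case: (Imax) => -[_ nI _] _; apply: nI; apply/seteqP; split=> // y _.
have : (P_Jmax L : set L) y by rewrite PT.
exact.
Qed.

End frattini_inclusions.

(** * Perfect algebras and the radical *)

Section homs_into_subalgebras.
Context {R : realType}.
Implicit Types L : banachLieType R.

Lemma lie_hom_comp (A B C : banachLieType R) (f : {linear B -> C}) (g : {linear A -> B}) :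
  lie_hom f -> lie_hom g -> lie_hom (f \o g).
Proof.
move=> [fl fb] [gl gb]; split; first by move=> a b /=; rewrite gl fl.
exact: bounded_comp.
Qed.

Lemma lie_hom_id L : lie_hom (idfun : {linear L -> L}).
Proof. by split=> //; exists 1 => // x; rewrite mul1r. Qed.

Definition subalg_incl L (K : closed_subalg L) : {linear subalg_type K -> L} := \val.

Lemma lie_hom_incl L (K : closed_subalg L) : lie_hom (subalg_incl K).
Proof. by split=> //; exists 1 => // x; rewrite mul1r. Qed.

Lemma subalg_inclP L (K : closed_subalg L) (k : subalg_type K) : subalg_set K (subalg_incl K k).
Proof. exact/set_mem/subalg_valP. Qed.

Lemma subalg_incl_inj L (K : closed_subalg L) : injective (subalg_incl K).
Proof. exact: val_inj. Qed.

Lemma subalg_incl_surj L (K : closed_subalg L) x : subalg_set K x ->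
  exists k : subalg_type K, subalg_incl K k = x.
Proof. by move=> /mem_set Kx; exists (SubalgElt Kx). Qed.

Lemma corestriction (A : banachLieType R) L (K : closed_subalg L) (f : {linear A -> L}) :
  (forall a, subalg_set K (f a)) -> bounded_map f ->
  exists2 g : {linear A -> subalg_type K}, forall a, subalg_incl K (g a) = f a & bounded_map g.
Proof.
move=> fK [C C0 fC].
pose g a : subalg_type K := SubalgElt (mem_set (fK a) : subalg_pred K (f a)).
have gl : linear g.
  by move=> k x y; apply: val_inj; rewrite /= linearP.
pose G : {linear A -> subalg_type K} := HB.pack g (GRing.isLinear.Build _ _ _ _ g gl).
exists G => //; by exists C => // a; exact: fC.
Qed.

Lemma corestriction_hom (A : banachLieType R) L (K : closed_subalg L) (f : {linear A -> L}) :
  (forall a, subalg_set K (f a)) -> lie_hom f ->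
  exists2 g : {linear A -> subalg_type K}, forall a, subalg_incl K (g a) = f a & lie_hom g.
Proof.
move=> fK [fl fb]; have [g gf gb] := corestriction fK fb; exists g => //.
split=> // a b; apply: subalg_incl_inj.
by rewrite gf fl -!gf (lie_hom_incl K).1.
Qed.

End homs_into_subalgebras.

Section perfect_algebras.
Context {R : realType}.
Implicit Types (A L : banachLieType R) (P Q : lie_map R).

(** Not [A, A] = A: the condition is that [A] has no proper closed subalgebra of finite
    codimension. *)
Definition perfect A := forall a, subalg_set (P_S A) a.

Definition intermediate P := forall L,
  (P_S L : set L) `<=` P L /\ (P L : set L) `<=` P_Jmax L.

Lemma lie_map_stepP P L (K : closed_subalg L) x :
  subalg_set (lie_map_step P K) x <->
  exists2 k, subalg_set (P (subalg_type K)) k & subalg_incl K k = x.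
Proof. by []. Qed.

(** At a successor, [f] corestricts to the power K already reached, and [P_S_hom] sends A = P_S A
    into P_S K, which lies in P K. *)
Lemma perfect_range_power P A L (f : {linear A -> L}) a b : intermediate P ->
  perfect A -> lie_hom f -> subalg_set (lie_power P L b) (f a).
Proof.
move=> iP pA fh; elim: b a => [//|b IH|J g IH] a; last first.
  by rewrite lie_power_supE => j _; exact: IH.
have [g gf gh] := corestriction_hom IH fh.
by apply/lie_map_stepP; exists (g a) => //; apply: (iP _).1; exact: P_S_hom.
Qed.

Lemma perfect_range_closure P A L (f : {linear A -> L}) a : intermediate P ->
  perfect A -> lie_hom f -> subalg_set (lie_closure P L) (f a).
Proof. exact: perfect_range_power. Qed.

Lemma lie_closure_stable P L : lie_map_step P (lie_closure P L) = lie_closure P L.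
Proof. by rewrite /lie_closure /stable_ordinal; case: (cid _) => b []. Qed.

Lemma stable_ordinal_min P L b : lie_power_stable P L b -> ole (stable_ordinal P L) b.
Proof. by rewrite /stable_ordinal; case: (cid _) => c [sc cmin] /=; exact: cmin. Qed.

Lemma intermediate_perfect P A : intermediate P ->
  (forall a, subalg_set (P A) a) -> perfect A.
Proof.
move=> iP PA a S FS; exfalso; apply: (P_Jmax_proper FS).
by apply/seteqP; split=> // x _; apply: (iP A).2; exact: PA.
Qed.

Lemma closure_perfect P L : intermediate P -> perfect (subalg_type (lie_closure P L)).
Proof.
move=> iP; apply: (intermediate_perfect iP) => k.
have := subalg_inclP k; rewrite -{1}lie_closure_stable => /lie_map_stepP[k' Pk'].
by move=> /subalg_incl_inj <-.
Qed.

(** Each closure is perfect, so its inclusion into [L] has range in the other. *)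
Lemma closure_eq P Q L : intermediate P -> intermediate Q ->
  lie_closure P L = lie_closure Q L :> set L.
Proof.
move=> iP iQ; apply/seteqP; split=> x /subalg_incl_surj[k <-].
  by apply: perfect_range_closure (lie_hom_incl _) => //; exact: closure_perfect.
by apply: perfect_range_closure (lie_hom_incl _) => //; exact: closure_perfect.
Qed.

Lemma closure_sub_power P Q L b : intermediate P -> intermediate Q ->
  (lie_closure P L : set L) `<=` lie_power Q L b.
Proof.
move=> iP iQ x /subalg_incl_surj[k <-].
by apply: perfect_range_power (lie_hom_incl _) => //; exact: closure_perfect.
Qed.

Lemma intermediate_P_S : intermediate (@P_S R).
Proof.
move=> L; split=> // x /P_S_sub_P_J/P_J_sub_P_Smax; exact: P_Smax_sub_P_Jmax.
Qed.

Lemma intermediate_P_J : intermediate (@P_J R).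
Proof.
move=> L; split; first exact: P_S_sub_P_J.
by move=> x /P_J_sub_P_Smax; exact: P_Smax_sub_P_Jmax.
Qed.

Lemma intermediate_P_Smax : intermediate (@P_Smax R).
Proof.
move=> L; split; last exact: P_Smax_sub_P_Jmax.
by move=> x /P_S_sub_P_J; exact: P_J_sub_P_Smax.
Qed.

Lemma intermediate_P_Jmax : intermediate (@P_Jmax R).
Proof.
move=> L; split=> // x /P_S_sub_P_J/P_J_sub_P_Smax; exact: P_Smax_sub_P_Jmax.
Qed.

(** An ideal of an ideal need not be an ideal, but ad x restricts to a bounded derivation of the
    ideal [K], and [P_Smax] of [K] is stable under it. *)
Lemma ideal_power_P_Smax L b : lie_absorbing (lie_power P_Smax L b : set L).
Proof.
elim: b => [//|b IH|J g IH] x y; last first.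
  by rewrite lie_power_supE => xg j _; apply: IH; exact: xg.
set K := lie_power P_Smax L b in IH.
move=> /lie_map_stepP[k Pk <-].
have [D DE Db] : exists2 D : {linear subalg_type K -> subalg_type K},
    forall k, subalg_incl K (D k) = lie x (subalg_incl K k) & bounded_map D.
  apply: (corestriction (f := lie x \o subalg_incl K)).
    by move=> z; exact/IH/subalg_inclP.
  by apply: bounded_comp; [exact: lie_bound|exact: (lie_hom_incl K).2].
apply/lie_map_stepP; exists (D k); last exact: DE.
apply: (P_Smax_derivation Db) => // u v; apply: subalg_incl_inj.
rewrite DE (lie_hom_incl K).1 lie_derivation [RHS]linearD.
by rewrite !(lie_hom_incl K).1 !DE.
Qed.

Lemma closure_ideal P L : intermediate P -> closed_lie_ideal (lie_closure P L).
Proof.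
move=> iP; rewrite (closure_eq L iP intermediate_P_Smax).
have [sK cK _] := closed_subalgP (lie_closure P_Smax L).
by split=> //; exact: ideal_power_P_Smax.
Qed.

(** Where the chain of [Q] stops, the power of [P] lies in the closure of [Q], which is contained in
    every power of [P], in particular in the next one. *)
Lemma stable_ordinal_le P Q L : intermediate P -> intermediate Q ->
  (forall b, (lie_power P L b : set L) `<=` lie_power Q L b ->
     (lie_power P L (Osucc b) : set L) `<=` lie_power Q L (Osucc b)) ->
  ole (stable_ordinal P L) (stable_ordinal Q L).
Proof.
move=> iP iQ step.
have PQ b : (lie_power P L b : set L) `<=` lie_power Q L b.
  elim: b => [//|b IH|J g IH]; first exact: step.
  by rewrite !lie_power_supE => x xg j _; apply: IH; exact: xg.
apply: stable_ordinal_min; apply: closed_subalg_inj; apply/seteqP; split.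
  exact: lie_map_step_sub.
move=> x /PQ; rewrite -/(lie_closure Q L); exact: closure_sub_power.
Qed.

Lemma power_step P Q L b :
  (forall (A B : banachLieType R) (f : {linear A -> B}), lie_hom f ->
     forall a, subalg_set (P A) a -> subalg_set (Q B) (f a)) ->
  (lie_power P L b : set L) `<=` lie_power Q L b ->
  (lie_power P L (Osucc b) : set L) `<=` lie_power Q L (Osucc b).
Proof.
move=> PQ sub x /lie_map_stepP[k Pk <-].
have [|g gE gh] := @corestriction_hom _ _ L (lie_power Q L b) _ _ (lie_hom_incl (lie_power P L b)).
  by move=> z; exact/sub/subalg_inclP.
apply/lie_map_stepP; exists (g k); last exact: gE.
exact: PQ.
Qed.

(** [P_Smax_hom] applies to the inclusion of powers because the powers of [P_Smax] are ideals of
    [L]. *)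
Lemma power_step_P_Jmax L b :
  (lie_power P_Smax L b : set L) `<=` lie_power P_Jmax L b ->
  (lie_power P_Smax L (Osucc b) : set L) `<=` lie_power P_Jmax L (Osucc b).
Proof.
move=> sub x /lie_map_stepP[k Pk <-].
have [|g gE gh] := @corestriction_hom _ _ L (lie_power P_Jmax L b) _ _ (lie_hom_incl (lie_power P_Smax L b)).
  by move=> z; exact/sub/subalg_inclP.
apply/lie_map_stepP; exists (g k); last exact: gE.
apply: (P_Smax_hom gh) => // u a Pa.
have : subalg_set (lie_power P_Smax L (Osucc b)) (lie (subalg_incl _ u) (subalg_incl _ a)).
  by apply: ideal_power_P_Smax; apply/lie_map_stepP; exists a.
move=> /lie_map_stepP[a' Pa' aE]; exists a' => //.
by apply: subalg_incl_inj; rewrite gE aE (lie_hom_incl _).1 gE.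
Qed.

End perfect_algebras.

Section quotients.
Context {R : realType} {L : banachLieType R} (I : closed_ideal L).

Lemma quotient_proj_linear : linear (quotient_proj I).
Proof. by move=> k x y; rewrite quotient_projD quotient_projZ. Qed.

Definition qproj : {linear L -> quotient_type I} :=
  HB.pack (quotient_proj I) (GRing.isLinear.Build _ _ _ _ _ quotient_proj_linear).

Lemma rnorm_quotient (q : quotient_type I) : rnorm q = quotient_norm q.
Proof. by apply: complexI; rewrite -normE quotient_normE. Qed.

Lemma rnorm_qproj x : rnorm (qproj x) <= rnorm x.
Proof.
rewrite rnorm_quotient; apply: ge_inf; last by exists x.
by exists 0 => _ [z _ <-]; exact: rnorm_ge0.
Qed.

Lemma qproj_lift x (e : R) : rnorm (qproj x) < e ->
  exists2 y, qproj y = qproj x & rnorm y < e.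
Proof.
rewrite rnorm_quotient => xe; apply: contrapT => h; move: xe; rewrite ltNge => /negP; apply.
apply: lb_le_inf; first by exists (rnorm x); exists x.
by move=> _ [y yx <-]; rewrite leNgt; apply/negP => ye; apply: h; exists y.
Qed.

Lemma qproj_hom : lie_hom qproj.
Proof.
split; first by move=> x y; rewrite [RHS]quotient_lieE.
by exists 1 => // x; rewrite mul1r rnorm_qproj.
Qed.

Lemma qproj_eq0 x : qproj x = 0 <-> ideal_set I x.
Proof.
by rewrite -[X in _ <-> _ X]subr0 -quotient_projE -[quotient_proj I 0]/(qproj 0) linear0.
Qed.

End quotients.

(** * The axioms of a radical *)

Section radical.
Context {R : realType} (P : lie_map R).
Hypothesis iP : intermediate P.
Implicit Types L M : banachLieType R.

Lemma closure_preradical : preradical (lie_closure P).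
Proof.
split=> [L|L M f [fl [k fk] _]]; first exact: closure_ideal.
have fh : lie_hom f.
  split=> //; exists `|k| => // x.
  rewrite -lecR rmorphM /= -!normE (le_trans (fk x))// ler_wpM2r// lecR ler_norm//.
move=> _ [x /subalg_incl_surj[u <-] <-].
apply: (perfect_range_closure (f := f \o subalg_incl (lie_closure P L))) => //.
  exact: closure_perfect.
by apply: lie_hom_comp => //; exact: lie_hom_incl.
Qed.

Lemma closure_lower_stable : lower_stable (lie_closure P).
Proof.
move=> L; apply: closed_subalg_inj; apply/seteqP; split; first exact: lie_map_step_sub.
move=> x /subalg_incl_surj[k <-]; apply/lie_map_stepP; exists k => //.
apply: (perfect_range_closure (f := idfun)) (lie_hom_id _) => //.
exact: closure_perfect.
Qed.

Lemma closure_balanced : balanced (lie_closure P).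
Proof.
move=> L I x /lie_map_stepP[y /subalg_incl_surj[u <-] <-].
apply: (perfect_range_closure (f := subalg_incl (ideal_subalg I) \o subalg_incl _)) => //.
  exact: closure_perfect.
by apply: lie_hom_comp; exact: lie_hom_incl.
Qed.

(** The preimage [T] of the closure [KQ] of the quotient is an extension of the perfect [KQ] by the
    perfect [lie_closure P L]. It is therefore perfect, hence contained in [lie_closure P L], so
    that [KQ] is zero. *)
Lemma closure_upper_stable : upper_stable (lie_closure P).
Proof.
move=> L PL; set I := ClosedIdeal PL; set Q := quotient_type I.
pose KQ := lie_closure P Q.
pose T : closed_subalg L := ClosedSubalg (preimage_subalgebra (qproj_hom I) (closed_subalgP KQ)).
have KT x : subalg_set (lie_closure P L) x -> subalg_set T x.
  move=> Kx; rewrite -[subalg_set T x]/(subalg_set KQ (qproj I x)) ((qproj_eq0 I x).2 Kx).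
  by case: (closed_subalgP KQ) => -[].
have [|j jE jh] := @corestriction_hom _ _ L T _ _ (lie_hom_incl (lie_closure P L)).
  by move=> k; exact/KT/subalg_inclP.
have [|p pE ph] := @corestriction_hom _ _ Q KQ (qproj I \o subalg_incl T) _
   (lie_hom_comp (qproj_hom I) (lie_hom_incl T)).
  by move=> t; exact: (subalg_inclP t).
have pT : perfect (subalg_type T).
  move=> t N FN; have [aN nN [n [e Ne]]] := FN; have [sN cN lN] := aN.
  (* [N] contains the kernel of [p], which is the image of a perfect algebra; so [N] is determined
     by its image [N'] in [KQ]. *)
  have jN k : N (j k) by apply: P_S_hom jh _ (closure_perfect iP k) N FN.
  have ker_p u : p u = 0 -> N u.
    move=> pu; have : qproj I (subalg_incl T u) = 0 by rewrite -[LHS]pE pu linear0.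
    move=> /qproj_eq0 /= /subalg_incl_surj[k ku].
    by rewrite -(subalg_incl_inj (etrans (jE k) ku)); exact: jN.
  have pN u v : p u = p v -> N v -> N u.
    move=> puv Nv; rewrite -[u](subrK v); apply: subspaceD => //; apply: ker_p.
    by rewrite linearB puv subrr.
  have psurj q : exists u, p u = q.
    have [y yq] := quotient_projP (subalg_incl KQ q).
    have Ty : subalg_set T y.
      by rewrite -[subalg_set T y]/(subalg_set KQ (quotient_proj I y)) yq; exact: subalg_inclP.
    have [u uy] := subalg_incl_surj Ty; exists u; apply: subalg_incl_inj.
    by rewrite pE -[LHS]/(qproj I (subalg_incl T u)) uy -yq.
  pose N' : set (subalg_type KQ) := p @` N.
  have sN' : linear_subspace N'.
    split; first by exists 0; [exact: subspace0|exact: linear0].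
    move=> c _ _ [u Nu <-] [v Nv <-]; exists (c *: u + v); [exact: sN.2|exact: linearP].
  (* The quotient norm is an infimum over cosets, so an approximation in [N'] lifts to one as close
     in [T], and the lift stays in [N] because [N] contains the kernel of [p]. *)
  have cN' : closed N'.
    apply/closed_approxP => q qN'; have [u uq] := psurj q; exists u => //.
    move/closed_approxP : cN; apply => d d0.
    have [_ [v Nv <-]] := qN' _ d0; rewrite -uq -linearB => uvd.
    have : rnorm (qproj I (subalg_incl T (u - v))) < d by rewrite -[qproj I _]pE.
    move=> /qproj_lift[y yE yd].
    have Ty : subalg_set T y.
      rewrite -[subalg_set T y]/(subalg_set KQ (qproj I y)) yE -[qproj I _]pE.
      exact: subalg_inclP.
    have [w wy] := subalg_incl_surj Ty.
    exists (u - w); last by rewrite subKr /rnorm subalg_normE -[val w]/(subalg_incl T w) wy.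
    apply: (pN _ v) => //; rewrite linearB.
    have -> : p w = p (u - v) by apply: subalg_incl_inj; rewrite !pE;
      rewrite -[LHS]/(qproj I (subalg_incl T w)) wy yE.
    by rewrite linearB subKr.
  have N'T q : N' q.
    have [->//|nN'] := pselect (N' = setT).
    apply: (closure_perfect iP q); split=> //.
      split=> // _ _ [u Nu <-] [v Nv <-]; exists (lie u v); [exact: lN|exact: ph.1].
    exists n, (p \o e) => x; have [u <-] := psurj x; have [c Nc] := Ne u.
    exists c; exists (u - \sum_i c i *: e i) => //.
    rewrite linearB linear_sum; congr (_ - _); apply: eq_bigr => i _.
    by rewrite linearZ.
  by have [u Nu up] := N'T (p t); exact: pN (esym up) Nu.
apply/seteqP; split=> q; last by move=> ->; case: (closed_subalgP KQ) => -[].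
have [y <-] := quotient_projP q => Ky.
have Ty : subalg_set T y by [].
have [t ty] := subalg_incl_surj Ty.
rewrite -[quotient_proj I y]/(qproj I y); apply/qproj_eq0; rewrite -ty.
exact: perfect_range_closure (lie_hom_incl T).
Qed.

Lemma closure_radical : radical (lie_closure P).
Proof.
split; [exact: closure_preradical|exact: closure_lower_stable| |exact: closure_balanced].
exact: closure_upper_stable.
Qed.

End radical.

Theorem theorem7p8 (R : realType) :
  (forall L : banachLieType R,
    [/\ (P_S L : set L) `<=` P_J L,
        (P_J L : set L) `<=` P_Smax L,
        (P_Smax L : set L) `<=` P_Jmax L
      & (exists S : set L,
           [/\ closed_lie_subalgebra S, S <> setT & finite_codim S]) ->
        (P_Jmax L : set L) <> setT]) /\
  ((forall L : banachLieType R,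
    [/\ lie_closure P_S L = lie_closure P_J L :> set L,
        lie_closure P_J L = lie_closure P_Smax L :> set L
      & lie_closure P_Smax L = lie_closure P_Jmax L :> set L]) /\
   [/\ radical (lie_closure (@P_S R)), radical (lie_closure (@P_J R)),
       radical (lie_closure (@P_Smax R)) & radical (lie_closure (@P_Jmax R))]) /\
  (forall L : banachLieType R,
    [/\ ole (stable_ordinal P_S L) (stable_ordinal P_J L),
        ole (stable_ordinal P_J L) (stable_ordinal P_Smax L)
      & ole (stable_ordinal P_Smax L) (stable_ordinal P_Jmax L)]).
Proof.
have iS := @intermediate_P_S R; have iJ := @intermediate_P_J R.
have iSm := @intermediate_P_Smax R; have iJm := @intermediate_P_Jmax R.
split=> [L|].
  split; [exact: P_S_sub_P_J|exact: P_J_sub_P_Smax|exact: P_Smax_sub_P_Jmax|].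
  by move=> [S FS]; exact: P_Jmax_proper FS.
split; first by split=> [L|]; split; (exact: closure_eq || exact: closure_radical).
move=> L; split; apply: stable_ordinal_le => // b.
- by apply: power_step => A B f fh a Pa; apply: P_S_sub_P_J; exact: P_S_hom.
- by apply: power_step => A B f fh a Pa; apply: P_J_sub_P_Smax; exact: P_J_hom.
- exact: power_step_P_Jmax.
Qed.
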